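(* Let $(X_t)_{t\in\mathbb{Z}}$ be a stationary and ergodic process defined on $(\Omega,\mathcal{F},\mathbb{P})$ with values in a Polish space $E$. Then, for every time lag $\eta\in\mathbb{N}$, $$\lim_{n\to\infty} C_n(\eta)=C(\eta),$$ where the convergence is $\mathbb{P}$-a.e. with respect to the Hilbert--Schmidt norm $\|\cdot\|_{S_2(\mathscr{H})}$.
   Context: Setting and standing assumptions: $(\Omega,\mathcal{F},\mathbb{P})$ is a probability space, $E$ is a Polish space with Borel $\sigma$-field $\mathcal{F}_E$, and $(X_t)_{t\in\mathbb{Z}}$ is an $E$-valued process that is stationary, i.e. for all $t_1,\dots,t_r\in\mathbb{Z}$, $r$ and time shifts $s\in\mathbb{N}$ the joint laws of $(X_{t_1},\dots,X_{t_r})$ and $(X_{t_1+s},\dots,X_{t_r+s})$ coincide. $\mathscr{H}$ is a separable real reproducing kernel Hilbert space of functions $E\to\mathbb{R}$ with kernel $k$ and canonical feature map $\varphi(x)=k(x,\cdot)$, assumed Borel measurable $E\to\mathscr{H}$; $\varphi(X_0)$ is Bochner square-integrable, and the embedded process is centered, $\mathbb{E}[\varphi(X_0)]=0$. Ergodicity: let $T:E^{\mathbb{Z}}\to E^{\mathbb{Z}}$ be the left shift $(T\omega)_i=\omega_{i+1}$. The process is ergodic if for every $M\in\mathcal{F}_E^{\otimes\mathbb{Z}}$ with $T^{-1}M=M$ one has $\mathbb{P}[(X_t)_{t\in\mathbb{Z}}\in M]\in\{0,1\}$. Notation: $\mathbb{N}=\{0,1,2,\dots\}$ for time lags. $S_2(\mathscr{H})$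 is the Hilbert space of Hilbert--Schmidt operators on $\mathscr{H}$; for $u,v\in\mathscr{H}$, $u\otimes v$ is the rank-one operator $h\mapsto\langle h,v\rangle_{\mathscr{H}}\,u$. The kernel autocovariance operator is $C(\eta)=\mathbb{E}[\varphi(X_\eta)\otimes\varphi(X_0)]$ and its empirical estimate is $C_n(\eta)=\frac1n\sum_{t=1}^n\varphi(X_{t+\eta})\otimes\varphi(X_t)$, $n\ge1$. *)

(* Defs.v *)
From HB Require Import structures.
From mathcomp Require Import all_boot all_order all_algebra.
From mathcomp Require Import all_classical all_reals all_analysis.
From mathcomp Require Import finmap ring lra.

Set Implicit Arguments.
Unset Strict Implicit.
Unset Printing Implicit Defensive.

Import Order.TTheory GRing.Theory Num.Theory.
Import numFieldNormedType.Exports.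

Local Open Scope classical_set_scope.
Local Open Scope ring_scope.

HB.mixin Record NormedModule_isInner (R : realType) H & NormedModule R H := {
  inner : H -> H -> R ;
  innerC : forall x y, inner x y = inner y x ;
  innerDl : forall x y z, inner (x + y) z = inner x z + inner y z ;
  innerZl : forall a x y, inner (a *: x) y = a * inner x y ;
  inner_norm : forall x, inner x x = `|x| ^+ 2
}.

#[short(type="hilbertType")]
HB.structure Definition Hilbert (R : realType) :=
  {H of CompleteNormedModule R H & NormedModule_isInner R H}.

Section inner_theory.
Context (R : realType) (H : hilbertType R).
Implicit Types x y z : H.

Lemma inner0l y : inner (0 : H) y = 0.
Proof. by rewrite -(scale0r (0 : H)) innerZl mul0r. Qed.

Lemma inner0r y : inner y (0 : H) = 0.
Proof. by rewrite innerC inner0l. Qed.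

Lemma innerDr x y z : inner x (y + z) = inner x y + inner x z.
Proof. by rewrite innerC innerDl !(innerC x). Qed.

Lemma innerZr a x y : inner x (a *: y) = a * inner x y.
Proof. by rewrite innerC innerZl (innerC x). Qed.

Lemma innerNl x y : inner (- x) y = - inner x y.
Proof. by rewrite -scaleN1r innerZl mulN1r. Qed.

Lemma innerNr x y : inner x (- y) = - inner x y.
Proof. by rewrite innerC innerNl innerC. Qed.

Lemma inner_suml (I : Type) (s : seq I) (F : I -> H) y :
  inner (\sum_(i <- s) F i) y = \sum_(i <- s) inner (F i) y.
Proof.
by elim/big_rec2: _ => [|i a b _ <-]; rewrite ?inner0l// innerDl.
Qed.

Lemma sqr_normD x y : `|x + y| ^+ 2 = `|x| ^+ 2 + inner x y *+ 2 + `|y| ^+ 2.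
Proof.
rewrite -!inner_norm innerDl !innerDr (innerC y x); ring.
Qed.

Lemma sqr_normB x y : `|x - y| ^+ 2 = `|x| ^+ 2 - inner x y *+ 2 + `|y| ^+ 2.
Proof. by rewrite sqr_normD innerNr normrN mulNrn. Qed.

Lemma inner_le x y : `|inner x y| <= `|x| * `|y|.
Proof.
have [->|y0] := eqVneq y 0; first by rewrite inner0r !normr0 mulr0.
have ny : 0 < `|y| ^+ 2 by rewrite exprn_gt0// normr_gt0.
have := sqr_ge0 `|x - (inner x y / `|y| ^+ 2) *: y|.
rewrite sqr_normB innerZr normrZ exprMn real_normK ?num_real//.
rewrite [X in 0 <= X](_ : _ = `|x| ^+ 2 - inner x y ^+ 2 / `|y| ^+ 2); last first.
  by field; rewrite normr_eq0.
rewrite subr_ge0 ler_pdivrMr// -exprMn -[_ ^+ 2]real_normK ?num_real//.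
by rewrite ler_pXn2r// ?nnegrE ?mulr_ge0.
Qed.

End inner_theory.

Section orthonormal_basis.
Context (R : realType) (H : hilbertType R).
Implicit Types (B : set H).

Definition orthonormal B :=
  forall x y, B x -> B y -> inner x y = if x == y then 1 else 0 : R.

Definition lspan B : set H := [set x | exists (s : seq H) (c : H -> R),
  (forall e, e \in s -> B e) /\ x = \sum_(e <- s) c e *: e].

Definition orthonormal_basis B := orthonormal B /\ dense (lspan B).

Lemma bessel (s : seq H) (v : H) : uniq s -> orthonormal [set` s] ->
  \sum_(e <- s) inner e v ^+ 2 <= `|v| ^+ 2.
Proof.
move=> us os; pose p := \sum_(e <- s) inner e v *: e.
have pe e : e \in s -> inner p e = inner e v.
  move=> es; rewrite inner_suml (bigD1_seq e)//= innerZl (os _ _ es es) eqxx mulr1.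
  rewrite big_seq_cond big1 ?addr0// => f /andP[fs fe].
  by rewrite innerZl (os _ _ fs es) (negbTE fe) mulr0.
have pv : inner p v = \sum_(e <- s) inner e v ^+ 2.
  by rewrite inner_suml; apply: eq_bigr => e _; rewrite innerZl -expr2.
have pp : inner p p = \sum_(e <- s) inner e v ^+ 2.
  rewrite {2}/p innerC inner_suml big_seq [RHS]big_seq.
  by apply: eq_bigr => e es; rewrite innerZl (innerC e p) pe// -expr2.
have := sqr_ge0 `|v - p|; rewrite sqr_normB -(inner_norm p) (innerC v) pv pp.
by move=> h; lra.
Qed.

Lemma lspanD B x y a : lspan B x -> lspan B y -> lspan B (x + a *: y).
Proof.
move=> [s [c [sB ->]]] [t [d [tB ->]]].
pose u := undup (s ++ t).
pose c' e := c e *+ count_mem e s + a * (d e *+ count_mem e t).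
have sumE (r : seq H) (f : H -> R) : {subset r <= u} ->
    \sum_(e <- r) f e *: e = \sum_(e <- u) (f e *+ count_mem e r) *: e.
  have uu : uniq u by exact: undup_uniq.
  elim: r => [_|z r IH sub].
    by rewrite big_nil big1// => e _; rewrite scale0r.
  rewrite big_cons IH; last by move=> e er; apply: sub; rewrite inE er orbT.
  have zu : z \in u by apply: sub; rewrite inE eqxx.
  rewrite (bigD1_seq z)//= [RHS](bigD1_seq z)//= addrA eqxx add1n mulrS scalerDl.
  congr (_ + _); apply: eq_bigr => e ez.
  by rewrite (eq_sym z) (negbTE ez) add0n.
exists u, c'; split.
  by move=> e; rewrite mem_undup mem_cat => /orP[/sB|/tB].
rewrite (sumE s c); last by move=> e es; rewrite mem_undup mem_cat es.
rewrite (sumE t d); last by move=> e et; rewrite mem_undup mem_cat et orbT.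
rewrite scaler_sumr -big_split/=; apply: eq_bigr => e _.
by rewrite scalerDl scalerA.
Qed.

Lemma lspan0 B : lspan B 0.
Proof. by exists [::], (fun=> 0); split=> //; rewrite big_nil. Qed.

Lemma lspan_in B e : B e -> lspan B e.
Proof.
move=> Be; exists [:: e], (fun=> 1); split.
  by move=> f; rewrite inE => /eqP ->.
by rewrite big_seq1 scale1r.
Qed.

Lemma total_dense B :
  (forall z, (forall e, B e -> inner z e = 0) -> z = 0) -> dense (lspan B).
Proof.
move=> Btot.
suff near_span (x : H) (eps : R) : 0 < eps -> exists2 s, lspan B s & `|x - s| < eps.
  move=> O [x Ox] Oopen.
  have /nbhs_ballP[eps /= eps0 xO] : nbhs x O by exact: open_nbhs_nbhs.
  have [s Ss xs] := near_span x _ eps0.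
  by exists s; split=> //; apply: xO; rewrite -ball_normE.
move=> eps0.
pose D := [set `|x - s| | s in lspan B].
have D0 : lbound D 0 by move=> _ [s _ <-].
have infD : has_inf D by split; [exists `|x - 0|, 0 => //; exact: lspan0|exists 0].
pose d := inf D.
have d0 : 0 <= d by apply: lb_le_inf => //; case: infD.
have dle s : lspan B s -> d <= `|x - s|.
  by move=> Ss; apply: ge_inf; [case: infD|exists s].
have app (e : R) : 0 < e -> exists2 s, lspan B s & `|x - s| < d + e.
  by move=> e0; have [_ [s Ss <-] h] := inf_adherent e0 infD; exists s.
have /choice[u uP] : forall n : nat,
    exists s, lspan B s /\ `|x - s| < d + n.+1%:R^-1.
  by move=> n; have [|s Ss h] := app n.+1%:R^-1; [rewrite invr_gt0|exists s].
have mid m n : `|u m - u n| ^+ 2 <=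
    `|x - u m| ^+ 2 *+ 2 + `|x - u n| ^+ 2 *+ 2 - d ^+ 2 *+ 4.
  pose c : H := 2^-1 *: (u m + u n).
  have Sc : lspan B c.
    rewrite -[c]add0r /c -(scale1r (u n)); apply: lspanD; first exact: lspan0.
    by apply: lspanD; [case: (uP m)|case: (uP n)].
  have : d ^+ 2 <= `|x - c| ^+ 2 by rewrite ler_pXn2r ?nnegrE// dle.
  have -> : x - c = 2^-1 *: ((x - u m) + (x - u n)).
    rewrite addrACA -opprD scalerBr -mulr2n -(scaler_nat 2 x) scalerA.
    by rewrite mulVf ?pnatr_eq0// scale1r.
  have -> : u m - u n = (x - u n) - (x - u m) by rewrite opprB [RHS]addrC addrA subrK.
  move: (x - u m) (x - u n) => a b.
  rewrite normrZ exprMn (sqr_normD a) (sqr_normB b) (innerC b).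
  rewrite ger0_norm ?invr_ge0//; lra.
have mid_lt m n (e : R) : 0 < e -> e <= 1 -> m.+1%:R^-1 <= e ->
    n.+1%:R^-1 <= e -> `|u m - u n| ^+ 2 <= (8 * d + 4) * e.
  move=> e0 e1 me ne; apply: (le_trans (mid m n)).
  have sqle k : k.+1%:R^-1 <= e -> `|x - u k| ^+ 2 <= (d + e) ^+ 2.
    move=> ke; rewrite ler_pXn2r ?nnegrE// ?addr_ge0 ?(ltW e0)//.
    by rewrite ltW// (lt_le_trans (uP k).2)// lerD2l.
  have := sqle _ me; have := sqle _ ne; nra.
have ucauchy : cauchy (u @ \oo).
  apply: cauchy_exP => e e0.
  pose k : R := Num.min 1 (e ^+ 2 / (8 * d + 5)).
  have d5 : 0 < 8 * d + 5 by lra.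
  have k0 : 0 < k by rewrite lt_min ltr01 divr_gt0// exprn_gt0.
  have [N _ Nk] := near_infty_natSinv_lt (PosNum k0).
  exists (u N), N => // n /= Nn; rewrite -ball_normE/=.
  rewrite -(@ltr_pXn2r _ 2)// ?nnegrE//; last exact: ltW.
  apply: (@le_lt_trans _ _ ((8 * d + 4) * k)).
    by apply: mid_lt => //; [rewrite ge_min lexx|exact/ltW/Nk/leqnn|exact/ltW/Nk].
  apply: (@lt_le_trans _ _ ((8 * d + 5) * k)); first by rewrite ltr_pM2r//; lra.
  by rewrite mulrC -ler_pdivlMr// ge_min lexx orbT.
pose p := lim (u @ \oo).
have up : u @ \oo --> p by exact: cauchy_cvg.
have approx (e : R) : 0 < e -> exists n, `|p - u n| < e /\ `|x - u n| < d + e.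
  move=> e0.
  have [N1 _ h1] := near_infty_natSinv_lt (PosNum e0).
  have [N2 _ h2] := (@cvgr_dist_lt _ _ _ _ _ _ _ up) _ e0.
  exists (maxn N1 N2); split; first exact/h2/leq_maxr.
  rewrite (lt_trans (uP _).2)// ltrD2l; exact/h1/leq_maxl.
have zle : `|x - p| <= d.
  apply/ler_addgt0Pr => e e0.
  have e2 : 0 < e / 2 by rewrite divr_gt0.
  have [n [pn xn]] := approx _ e2.
  have -> : x - p = (x - u n) - (p - u n) by rewrite opprB addrA subrK.
  by rewrite (le_trans (ler_normB _ _))//; lra.
have zge (s : H) (t : R) : lspan B s -> d <= `|x - p - t *: s|.
  move=> Ss; apply/ler_addgt0Pr => e e0.
  have [n [pn xn]] := approx _ e0.
  have Sn : lspan B (u n + t *: s) by apply: lspanD => //; case: (uP n).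
  rewrite (le_trans (dle _ Sn))//.
  have -> : x - (u n + t *: s) = (x - p - t *: s) + (p - u n).
    by rewrite opprD addrA [RHS]addrAC subrKA.
  by rewrite (le_trans (ler_normD _ _))// lerD2l ltW.
have zorth (s : H) : lspan B s -> inner (x - p) s = 0.
  move=> Ss; have quad (t : R) : inner (x - p) s * t *+ 2 <= t ^+ 2 * `|s| ^+ 2.
    have : `|x - p| ^+ 2 <= `|x - p - t *: s| ^+ 2.
      by rewrite ler_pXn2r ?nnegrE// (le_trans zle)// zge.
    rewrite [X in _ <= X]sqr_normB innerZr normrZ exprMn real_normK ?num_real//; lra.
  have [->|s0] := eqVneq s 0; first by rewrite inner0r.
  have sn : 0 < `|s| ^+ 2 by rewrite exprn_gt0// normr_gt0.
  have := quad (inner (x - p) s / `|s| ^+ 2).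
  set a := inner _ _; set b := `|s| ^+ 2 in sn *.
  rewrite expr_div_n (_ : a ^+ 2 / b ^+ 2 * b = a ^+ 2 / b); last by field; lra.
  rewrite mulrA -expr2 mulr2n -lerBrDl subrr => h.
  apply/eqP; rewrite -sqrf_eq0 eq_le sqr_ge0 andbT.
  by rewrite -(@pmulr_lle0 _ b^-1) ?invr_gt0.
have xp : x - p = 0 by apply: Btot => e Be; apply: zorth; exact: lspan_in.
have [n [pn _]] := approx _ eps0.
by exists (u n); [case: (uP n)|rewrite (subr0_eq xp)].
Qed.

Lemma exists_orthonormal_basis : exists B, orthonormal_basis B.
Proof.
have [F FP Ftot|B [oB Bmax]] := @Zorn_bigcup H orthonormal.
  move=> x y [X FX Xx] [Y FY Yy].
  by have [XY|YX] := Ftot _ _ FX FY; [apply: (FP Y)|apply: (FP X)] => //;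
    [exact: XY|exact: YX].
exists B; split=> //; apply: total_dense => z zB.
apply/eqP; apply: contrapT => /negP z0.
pose w := `|z|^-1 *: z.
have nw : `|w| = 1 by rewrite normfZV.
have wB e : B e -> inner w e = 0 by move=> Be; rewrite innerZl zB// mulr0.
have ww : inner w w = 1 by rewrite inner_norm nw expr1n.
have wnB : ~ B w by move=> /wB; rewrite ww => /eqP; rewrite oner_eq0.
apply: (Bmax (B `|` [set w])).
  split; first by left.
  by move=> /(_ w) h; apply: wnB; apply: h; right.
move=> x y [Bx|->] [By|->].
- exact: oB.
- rewrite innerC wB//; case: eqP => // xw; by rewrite xw in Bx.
- rewrite wB//; case: eqP => // xw; by rewrite -xw in By.
- by rewrite eqxx.
Qed.

Definition hbasis : set H := sval (cid exists_orthonormal_basis).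

Lemma hbasisP : orthonormal_basis hbasis.
Proof. exact: svalP (cid exists_orthonormal_basis). Qed.

End orthonormal_basis.
Arguments hbasis {R} H.

Section hilbert_schmidt.
Context (R : realType) (H : hilbertType R).
Implicit Types (A : H -> H) (u v : H).

Definition bounded_operator A :=
  linear A /\ exists M : R, forall x, `|A x| <= M * `|x|.

(* $\sum_{e} \|A e\|^2$ over a fixed orthonormal basis; for bounded A the sum
   does not depend on the basis *)
Definition hs_sqnorm A : \bar R := \esum_(e in hbasis H) ((`|A e| ^+ 2)%:E).

Definition hilbert_schmidt : {pred H -> H} :=
  fun A => `[< bounded_operator A /\ (hs_sqnorm A < +oo)%E >].

Lemma hs_sqnorm_ge0 A : (0 <= hs_sqnorm A)%E.
Proof. by apply: esum_ge0 => e _; rewrite lee_fin sqr_ge0. Qed.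

Let le_esumZ (c : R) (a : H -> R) : 0 < c -> (forall e, 0 <= a e) ->
  (\esum_(e in hbasis H) ((c * a e)%:E) <=
   c%:E * \esum_(e in hbasis H) ((a e)%:E))%E.
Proof.
move=> c0 a0; apply: ge_ereal_sup => _ [X [finX XB] <-].
rewrite (eq_fsbigr (fun e => c%:E * (a e)%:E)%E); last first.
  by move=> e _; rewrite EFinM.
rewrite -ge0_mule_fsumr//.
by apply: lee_wpmul2l; [rewrite lee_fin ltW|apply: esum_ge; exists X].
Qed.

Let hs_sqnormD_weight A1 A2 (t : R) : 0 < t ->
  (hs_sqnorm (A1 + A2)%R <=
   (1 + t)%R%:E * hs_sqnorm A1 + (1 + t^-1)%R%:E * hs_sqnorm A2)%E.
Proof.
move=> t0; have ti0 : 0 < t^-1 by rewrite invr_gt0.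
apply: (@le_trans _ _ (\esum_(e in hbasis H)
    (((1 + t) * `|A1 e| ^+ 2)%:E + ((1 + t^-1) * `|A2 e| ^+ 2)%:E))%E).
  apply: le_esum => e _; rewrite -EFinD lee_fin.
  have h : `|A1 e + A2 e| ^+ 2 <= (`|A1 e| + `|A2 e|) ^+ 2.
    by rewrite ler_pXn2r ?nnegrE ?addr_ge0// ler_normD.
  apply: (le_trans h); move: `|A1 e| `|A2 e| => a b.
  rewrite -subr_ge0.
  rewrite [X in 0 <= X](_ : _ = t * (a - t^-1 * b) ^+ 2); last first.
    by field; rewrite gt_eqF.
  by rewrite mulr_ge0 ?sqr_ge0// ltW.
rewrite esumD; last 2 first.
- by move=> e _; rewrite lee_fin mulr_ge0 ?sqr_ge0// addr_ge0// ltW.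
- by move=> e _; rewrite lee_fin mulr_ge0 ?sqr_ge0// addr_ge0// ltW.
by apply: leeD; apply: le_esumZ => //; rewrite ?addr_gt0// => e; rewrite sqr_ge0.
Qed.

Let hs_sqnormZ_le (c : R) A : c != 0 ->
  (hs_sqnorm (c *: A)%R <= (c ^+ 2)%R%:E * hs_sqnorm A)%E.
Proof.
move=> c0; rewrite {1}/hs_sqnorm.
rewrite (eq_esum (b := fun e => (c ^+ 2 * `|A e| ^+ 2)%:E)).
  by apply: le_esumZ => [|e]; rewrite ?sqr_ge0// exprn_even_gt0.
by move=> e _; rewrite normrZ exprMn real_normK ?num_real.
Qed.

Let hs_sqnorm0 : hs_sqnorm 0 = 0%E.
Proof. by apply: esum1 => e _; rewrite normr0 expr0n. Qed.

Lemma hilbert_schmidt_submod_closed : submod_closed hilbert_schmidt.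
Proof.
split=> [|c A1 A2].
  apply/asboolP; split; last by rewrite hs_sqnorm0 ltry.
  split; first by move=> a x y; rewrite /= scaler0 addr0.
  by exists 0 => x; rewrite normr0 mul0r.
move=> /asboolP[[l1 [M1 b1]] f1] /asboolP[[l2 [M2 b2]] f2].
apply/asboolP; split.
  split.
    move=> a x y; rewrite /= !fctE l1 l2 !scalerDr !scalerA (mulrC c a).
    by rewrite !addrA; congr (_ + _); rewrite -!addrA; congr (_ + _); rewrite addrC.
  exists (`|c| * M1 + M2) => x; rewrite (le_trans (ler_normD _ _))//.
  by rewrite mulrDl lerD// normrZ -mulrA ler_wpM2l.
have [->|c0] := eqVneq c 0; first by rewrite scale0r add0r.
apply: (le_lt_trans (hs_sqnormD_weight _ _ ltr01)).
have fin2 (k : R) A : 0 <= k -> (hs_sqnorm A < +oo -> k%:E * hs_sqnorm A < +oo)%E.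
  by move=> k0 fA; rewrite lte_mul_pinfty// lee_fin.
rewrite lte_add_pinfty//; apply: (fin2 _ _); rewrite ?addr_ge0 ?invr_ge0//.
by apply: (le_lt_trans (hs_sqnormZ_le A1 c0)); apply: (fin2 _ _); rewrite ?sqr_ge0.
Qed.

HB.instance Definition _ :=
  GRing.isSubmodClosed.Build R (H -> H) hilbert_schmidt
    hilbert_schmidt_submod_closed.

Record S2 := MkS2 {
  S2_op :> H -> H ;
  S2_opP : S2_op \in hilbert_schmidt }.

HB.instance Definition _ := [isSub for S2_op].
HB.instance Definition _ := [Choice of S2 by <:].
HB.instance Definition _ := [SubChoice_isSubLmodule of S2 by <:].

Definition S2_norm (A : S2) : R := Num.sqrt (fine (hs_sqnorm A)).

Lemma S2_bounded (A : S2) : bounded_operator A.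
Proof. by case: A => A /= /asboolP[]. Qed.

Lemma S2_sqnorm (A : S2) : hs_sqnorm A = (S2_norm A ^+ 2)%:E.
Proof.
have := S2_opP A => /asboolP[_ fA].
rewrite /S2_norm sqr_sqrtr ?fine_ge0 ?hs_sqnorm_ge0// fineK//.
by rewrite ge0_fin_numE// hs_sqnorm_ge0.
Qed.

Let S2_norm_eq0_basis (A : S2) : S2_norm A = 0 -> forall e, hbasis H e -> A e = 0.
Proof.
move=> A0 e Be; have := S2_sqnorm A; rewrite A0 expr0n/= => hA.
have : ((`|A e| ^+ 2)%:E <= hs_sqnorm A)%E.
  apply: esum_ge; exists [set e].
    by split; [exact: finite_set1|move=> _ ->].
  by rewrite fsbig_set1.
rewrite hA lee_fin => h; apply/eqP; rewrite -normr_eq0 -sqrf_eq0.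
by rewrite eq_le h sqr_ge0.
Qed.

Let S2_norm0_eq0 (A : S2) : S2_norm A = 0 -> A = 0.
Proof.
move=> /S2_norm_eq0_basis A0; apply/val_inj/funext => x /=.
have [lA [M Mb]] := S2_bounded A.
have A00 : A 0 = 0.
  by have := lA 1 0 0; rewrite !scale1r addr0 => /eqP; rewrite -subr_eq0 opprD addrA subrr sub0r oppr_eq0 => /eqP.
have Aspan (y : H) : lspan (hbasis H) y -> A y = 0.
  move=> [s [c [sB ->]]]; elim: s sB => [|e s IH] sB; first by rewrite big_nil.
  rewrite big_cons lA A0 ?scaler0 ?add0r; last by apply: sB; rewrite inE eqxx.
  by apply: IH => f fs; apply: sB; rewrite inE fs orbT.
apply/eqP; rewrite -normr_eq0 eq_le normr_ge0 andbT.
apply/ler_addgt0Pr => e e0; rewrite add0r.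
have k0 : 0 < e / (`|M| + 1) by rewrite divr_gt0// ltr_wpDl.
have [_ Bdense] := hbasisP H.
have [||y [xy Sy]] := Bdense (ball x (e / (`|M| + 1))).
- by exists x; exact: ballxx.
- exact: ball_open.
have -> : A x = A (x - y).
  have := lA (-1) y x; rewrite !scaleN1r (Aspan _ Sy) oppr0 add0r => <-.
  by rewrite addrC.
move: xy; rewrite -ball_normE/= ltr_pdivlMr ?ltr_wpDl// => /ltW xy.
rewrite (le_trans (Mb _))//; apply: le_trans xy.
by rewrite mulrC ler_wpM2l// (le_trans (ler_norm M))// lerDl.
Qed.

Let S2_normD (A1 A2 : S2) : S2_norm (A1 + A2) <= S2_norm A1 + S2_norm A2.
Proof.
have n0 (A : S2) : 0 <= S2_norm A by exact: sqrtr_ge0.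
have [/S2_norm0_eq0 ->|a0] := eqVneq (S2_norm A1) 0.
  by rewrite add0r lerDr.
have [/S2_norm0_eq0 ->|b0] := eqVneq (S2_norm A2) 0.
  by rewrite addr0 lerDl.
have a1 : 0 < S2_norm A1 by rewrite lt_neqAle eq_sym a0 n0.
have b1 : 0 < S2_norm A2 by rewrite lt_neqAle eq_sym b0 n0.
rewrite -(@ler_pXn2r _ 2)// ?nnegrE ?addr_ge0// -lee_fin -S2_sqnorm.
have t0 : 0 < S2_norm A2 / S2_norm A1 by rewrite divr_gt0.
apply: (le_trans (hs_sqnormD_weight A1 A2 t0)).
rewrite !S2_sqnorm -!EFinM -EFinD lee_fin le_eqVlt; apply/orP; left; apply/eqP.
by field; rewrite a0 b0.
Qed.

Let S2_normZ (c : R) (A : S2) : S2_norm (c *: A) = `|c| * S2_norm A.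
Proof.
have n0 (B : S2) : 0 <= S2_norm B by exact: sqrtr_ge0.
have le_normZ (k : R) (B : S2) : k != 0 -> S2_norm (k *: B) <= `|k| * S2_norm B.
  move=> k0; rewrite -(@ler_pXn2r _ 2)// ?nnegrE ?mulr_ge0//.
  rewrite -lee_fin -S2_sqnorm exprMn real_normK ?num_real// EFinM -S2_sqnorm.
  exact: hs_sqnormZ_le.
have [->|c0] := eqVneq c 0.
  by rewrite scale0r normr0 mul0r /S2_norm hs_sqnorm0 sqrtr0.
apply/eqP; rewrite eq_le le_normZ//=.
have := le_normZ c^-1 (c *: A); rewrite scalerA mulVf// scale1r normfV.
by rewrite ler_pdivlMl ?normr_gt0// invr_eq0; exact.
Qed.

HB.instance Definition _ :=
  @Lmodule_isNormed.Build R S2 S2_norm S2_normD S2_normZ S2_norm0_eq0.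

Definition rank_one (u v : H) : H -> H := fun h => inner h v *: u.

Lemma rank_one_hilbert_schmidt u v : rank_one u v \in hilbert_schmidt.
Proof.
have oB : orthonormal (hbasis H) by case: (hbasisP H).
apply/asboolP; split; first split.
- by move=> a x y; rewrite /rank_one innerDl innerZl scalerDl scalerA.
- exists (`|v| * `|u|) => x; rewrite /rank_one normrZ (mulrC _ `|x|) mulrA.
  by rewrite ler_wpM2r// inner_le.
apply: (@le_lt_trans _ _ ((`|v| ^+ 2 * `|u| ^+ 2)%:E)); last exact: ltry.
apply: ge_ereal_sup => _ [X [finX XB] <-].
rewrite fsbig_finite//= sumEFin lee_fin.
rewrite (eq_bigr (fun e => inner e v ^+ 2 * `|u| ^+ 2)); last first.
  by move=> e _; rewrite /rank_one normrZ exprMn real_normK ?num_real.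
rewrite -mulr_suml ler_wpM2r ?sqr_ge0//; apply: bessel; first exact: fset_uniq.
have XS x : x \in fset_set X -> hbasis H x.
  by rewrite in_fset_set// => /set_mem /XB.
by move=> x y /= /XS Bx /XS By; exact: oB.
Qed.

Definition tensor (u v : H) : S2 := MkS2 (rank_one_hilbert_schmidt u v).

End hilbert_schmidt.

Section bochner.
Context d (T : measurableType d) (R : realType) (V : normedModType R).
Variable P : probability T R.
Implicit Types (s f : T -> V).

Definition simple_map s :=
  finite_set (range s) /\ forall v, measurable (s @^-1` [set v]).

Definition simple_integral s : V :=
  \sum_(v \in range s) fine (P (s @^-1` [set v])) *: v.

Definition strongly_measurable f := exists s_ : (T -> V)^nat,
  (forall n, simple_map (s_ n)) /\
  {ae P, forall x, s_ n x @[n --> \oo] --> f x}.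

Definition has_bochner_integral f (I : V) := exists s_ : (T -> V)^nat,
  [/\ forall n, simple_map (s_ n),
      {ae P, forall x, s_ n x @[n --> \oo] --> f x},
      (\int[P]_x (`|f x - s_ n x|%:E))%E @[n --> \oo] --> 0%E &
      simple_integral (s_ n) @[n --> \oo] --> I].

(* 0 when f is not Bochner integrable *)
Definition bochner_integral f : V := xget 0 [set I | has_bochner_integral f I].

Definition square_integrable f :=
  strongly_measurable f /\ (\int[P]_x ((`|f x| ^+ 2)%:E) < +oo)%E.

End bochner.

Definition separable (T : topologicalType) :=
  exists2 D : set T, countable D & dense D.

Definition polish (R : realType) (E : topologicalType) :=
  separable E /\
  exists rho : E -> E -> R,
    [/\ forall x y, rho x y = 0 <-> x = y,
        forall x y, rho x y = rho y x,
        forall x y z, rho x z <= rho x y + rho y z,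
        forall x (A : set E), nbhs x A <->
          exists2 e : R, 0 < e & [set y | rho x y < e] `<=` A &
        forall u : E^nat,
          (forall e : R, 0 < e -> exists N : nat, forall m n : nat,
             (N <= m)%N -> (N <= n)%N -> rho (u m) (u n) < e) ->
          exists l : E, u n @[n --> \oo] --> l].

Notation borel E := (g_sigma_algebraType (@open E)).

(* Hilbert space of functions E -> R: elements of [rkhs_space] are identified
   with functions through the injective linear map [rkhs_eval]; [feature x] is
   the element k(x, .) *)
Record rkhs (R : realType) (E : Type) := RKHS {
  rkhs_space :> hilbertType R ;
  rkhs_eval : rkhs_space -> E -> R ;
  rkhs_eval_linear : forall a f g x,
    rkhs_eval (a *: f + g) x = a * rkhs_eval f x + rkhs_eval g x ;
  rkhs_eval_inj : injective rkhs_eval ;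
  rkhs_kernel : E -> E -> R ;
  feature : E -> rkhs_space ;
  feature_eval : forall x, rkhs_eval (feature x) = rkhs_kernel x ;
  reproducing : forall f x, inner f (feature x) = rkhs_eval f x }.

Section process.
Context d (Omega : measurableType d) (R : realType) (P : probability Omega R).
Context (E : ptopologicalType) (X : int -> {mfun Omega >-> borel E}).

Definition joint (r : nat) (t : r.-tuple int) (w : Omega) : r.-tuple (borel E) :=
  [tuple X (tnth t i) w | i < r].

Definition stationary := forall (r : nat) (t : r.-tuple int) (s : nat)
    (A : set (r.-tuple (borel E))), measurable A ->
  pushforward P (joint [tuple tnth t i + s%:Z | i < r]) A =
  pushforward P (joint t) A.

Definition path_sigma_algebra : set (set (int -> E)) :=
  <<s \bigcup_(i in [set: int])
        preimage_set_system setT (fun x : int -> borel E => x i) measurable >>.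

Definition shift (x : int -> E) : int -> E := fun i => x (i + 1).

Definition ergodic := forall M : set (int -> E), path_sigma_algebra M ->
  shift @^-1` M = M ->
  P [set w | M (fun t => X t w)] = 0%E \/ P [set w | M (fun t => X t w)] = 1%E.

Variable H : rkhs R E.

Definition autocov (eta : nat) : S2 H :=
  bochner_integral P
    (fun w => tensor (feature H (X eta%:Z w)) (feature H (X 0 w))).

Definition empirical_autocov (eta n : nat) (w : Omega) : S2 H :=
  n%:R^-1 *: \sum_(1 <= t < n.+1)
    tensor (feature H (X (t + eta)%N%:Z w)) (feature H (X t%:Z w)).

End process.

(* Main.v *)
From HB Require Import structures.
From Pilot Require Import Defs.
From mathcomp Require Import all_boot all_order all_algebra.
From mathcomp Require Import all_classical all_reals all_analysis.
From mathcomp Require Import measurable_realfun.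
From mathcomp Require Import finmap ring lra.

Set Implicit Arguments.
Unset Strict Implicit.
Unset Printing Implicit Defensive.

Import Order.TTheory GRing.Theory Num.Theory numFieldNormedType.Exports.

Local Open Scope classical_set_scope.
Local Open Scope ring_scope.

(** The statement is the ergodic theorem for the stationary sequence of
    Hilbert--Schmidt operators $\varphi(X_{t+\eta})\otimes\varphi(X_t)$, and the
    proof reduces it to the scalar ergodic theorem by approximation with maps
    taking finitely many values.

    The scalar theorem is proved for an ergodic measure-preserving map $\theta$
    of a probability space.  The heart is [birkhoff_sum_bounded]: when
    $\int f<0$, almost every sequence of Birkhoff sums of $f$ is bounded above.
    With $M_n$ the maximum of the first $n$ sums and $0$, one has
    $M_{n+1}-M_n\circ\theta=\max(-M_n\circ\theta,f)$, whose integral is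
    $\int(M_{n+1}-M_n)\ge0$; the set where $M_n\to\infty$ is invariant, and if
    it had full measure dominated convergence would give $\int f\ge0$.
    Applying this to $\pm(f-\int f)-1/(k+1)$ for all $k$ gives convergence of
    the averages ([birkhoff]).

    For a map $f$ with values in a normed space and Bochner integral $I$, choose
    simple maps $s_k$ with $\int\|f-s_k\|\to0$ and $\int s_k\to I$.  The average
    of $f$ is within the average of $\|f-s_k\|$ of the average of $s_k$; the
    scalar theorem applies to $\|f-s_k\|$ and to the indicators of the level
    sets of $s_k$, so that the averages of $f$ tend to $I$
    ([bochner_birkhoff]).

    This is applied to the shift on the space of trajectories under the law of
    the process, which stationarity makes invariant because the law is
    determined by its values on cylinders ([shift_preserving]).  The operator
    $\varphi(x_\eta)\otimes\varphi(x_0)$ has a Bochner integral there: as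
    $\mathscr{H}$ is separable, $\varphi(x_i)$ is a pointwise limit of simple
    maps, the tensors of these approximate the operator, and
    $\|u\otimes v\|\le\|u\|\|v\|$ together with square integrability allows
    dominated convergence.  The simple integrals then form a Cauchy sequence,
    which converges because $S_2(\mathscr{H})$ is complete ([S2_complete]).  By
    uniqueness of the Bochner integral its value is $C(\eta)$. *)

(** * Measure-preserving maps *)

Section measure_preserving.
Context (R : realType) d1 d2 (T1 : measurableType d1) (T2 : measurableType d2).
Context (mu1 : {measure set T1 -> \bar R}) (mu2 : {measure set T2 -> \bar R}).

Definition measure_preserving (g : T1 -> T2) :=
  measurable_fun setT g /\
  forall A, measurable A -> mu1 (g @^-1` A) = mu2 A.

Context (g : T1 -> T2) (gP : measure_preserving g).

Lemma ge0_integral_comp (f : T2 -> \bar R) :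
  measurable_fun setT f -> (forall y, 0 <= f y)%E ->
  (\int[mu1]_x f (g x) = \int[mu2]_y f y)%E.
Proof.
have [mg gmu] := gP; move=> mf f0.
have := @ge0_integral_pushforward _ _ _ _ _ _ mg mu1 setT f measurableT mf.
rewrite preimage_setT => <-; last by move=> y _; exact: f0.
by apply: (eq_measure_integral mu2) => A mA _; exact: gmu.
Qed.
Lemma integral_comp (f : T2 -> \bar R) :
  measurable_fun setT f ->
  (\int[mu1]_x f (g x) = \int[mu2]_y f y)%E.
Proof.
move=> mf; rewrite [LHS]integralE [RHS]integralE; congr (_ - _)%E.
  rewrite [X in integral _ _ X](funepos_comp f g).
  by apply: ge0_integral_comp => //; exact: measurable_funepos.
rewrite [X in integral _ _ X](funeneg_comp f g).
by apply: ge0_integral_comp => //; exact: measurable_funeneg.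
Qed.

Lemma integrable_comp (f : T2 -> \bar R) :
  mu2.-integrable setT f -> mu1.-integrable setT (f \o g).
Proof.
have [mg _] := gP.
move=> /integrableP[mf fi]; apply/integrableP; split.
  exact: measurableT_comp.
rewrite (_ : (\int[mu1]_x _)%E = (\int[mu2]_x `|f x|)%E)//.
rewrite -ge0_integral_comp//; exact: measurableT_comp.
Qed.

Lemma ae_comp (Q : T2 -> Prop) :
  {ae mu2, forall y, Q y} -> {ae mu1, forall x, Q (g x)}.
Proof.
have [mg gmu] := gP.
move=> [N [mN N0 QN]]; exists (g @^-1` N); split.
- by rewrite -[X in measurable X]setTI; exact: mg.
- by rewrite -N0; exact: gmu.
- by move=> x /= nQ; exact: (QN (g x)).
Qed.

End measure_preserving.

(** * The scalar ergodic theorem *)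

Section birkhoff.
Context (R : realType) d (T : measurableType d) (mu : probability T R).
Context (th : T -> T) (thP : measure_preserving mu mu th).
Hypothesis erg : forall M, measurable M -> th @^-1` M = M ->
  mu M = 0%E \/ mu M = 1%E.

Section maximal.
Variable f : T -> R.
Hypothesis fi : mu.-integrable setT (EFin \o f).

(** The maximum of $0$ and of the first [n] Birkhoff sums of [f], in the recursive
    form on which the maximal inequality rests. *)
Fixpoint max_sum (n : nat) (x : T) : R :=
  if n is m.+1 then Num.max 0 (f x + max_sum m (th x)) else 0.

Let S (n : nat) x := \sum_(i < n) f (iter i th x).

Lemma birkhoff_sumS n x : S n.+1 x = f x + S n (th x).
Proof.
rewrite /S big_ord_recl/=; congr (_ + _).
by apply: eq_bigr => i _; rewrite -iterS iterSr.
Qed.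

Lemma max_sum_ge n x : S n x <= max_sum n x.
Proof.
elim: n x => [|n IH] x; first by rewrite /S big_ord0.
by rewrite birkhoff_sumS /= le_max lerD2l IH orbT.
Qed.

Lemma max_sum_ge0 n x : 0 <= max_sum n x.
Proof. by case: n => [|n] //=; rewrite le_max lexx. Qed.

Lemma max_sum_le n x : max_sum n x <= max_sum n.+1 x.
Proof.
elim: n x => [|n IH] x; first exact: max_sum_ge0.
by rewrite /= le_max2// lerD2l; exact: IH.
Qed.

Lemma max_sum_nd m n x : (m <= n)%N -> max_sum m x <= max_sum n x.
Proof.
by move=> mn; have /nondecreasing_seqP := max_sum_le ^~ x; exact.
Qed.

Lemma integrable_max_sum n : mu.-integrable setT (EFin \o max_sum n).
Proof.
elim: n => [|n IH]; first exact: (finite_measure_integrable_cst mu 0).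
have h : mu.-integrable setT (EFin \o (fun x => f x + max_sum n (th x))).
  have := integrable_comp thP IH.
  by move=> /(integrableD measurableT fi); exact.
apply: (le_integrable measurableT _ _ h).
  have := measurable_int _ h => /measurable_EFinP h'.
  by apply/measurable_EFinP; exact: measurable_maxr.
move=> x _ /=; rewrite lee_fin ger0_norm ?le_max ?lexx//.
by rewrite ge_max normr_ge0 ler_norm.
Qed.

Let A := [set x | forall K : nat, exists n, K%:R < max_sum n x].

Let mA : measurable A.
Proof.
rewrite (_ : A = \bigcap_K \bigcup_n [set x | K%:R < max_sum n x]); last first.
  rewrite eqEsubset; split=> x Ax.
    by move=> K _; have [n ?] := Ax K; exists n.
  by move=> K; have [n _ ?] := Ax K I; exists n.
apply: bigcap_measurable => // K _; apply: bigcup_measurable => n _.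
have := measurable_int _ (integrable_max_sum n) => /measurable_EFinP h.
rewrite -[X in measurable X]setTI; have := h measurableT `]K%:R, +oo[%classic.
rewrite (_ : max_sum n @^-1` _ = [set x | K%:R < max_sum n x]).
  by apply; exact: measurable_itv.
by apply/seteqP; split => x /=; rewrite in_itv/= andbT.
Qed.

Let thA : th @^-1` A = A.
Proof.
apply/seteqP; split => x Ax K.
  have [n] := Ax (Num.bound `|K%:R - f x|).
  move=> h; exists n.+1 => /=; rewrite lt_max -ltrBlDl; apply/orP; right.
  apply: lt_trans h; apply: le_lt_trans (ler_norm _) _.
  exact: archi_boundP.
have [[|n] h] := Ax (Num.bound (K%:R + `|f x|)).
  by move: h; rewrite /= ltNge ler0n.
exists n; move: h; rewrite /= lt_max ltNge ler0n/= => h.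
have : K%:R + `|f x| < f x + max_sum n (th x).
  by apply: lt_trans h; apply: archi_boundP; rewrite addr_ge0.
by move=> /lt_le_trans/(_ (lerD (ler_norm (f x)) (lexx _))); rewrite addrC ltrD2l.
Qed.

(** The sums are unbounded above on an invariant set.  If that set had full
    measure, the functions [D n] below, which have nonnegative integral by
    invariance of the measure, would converge to [f] while dominated by [|f|]. *)
Lemma birkhoff_sum_bounded : (\int[mu]_x (f x)%:E < 0)%E ->
  {ae mu, forall x, exists K : R, forall n, S n x <= K}.
Proof.
move=> f0; have [A0|A1] := erg mA thA.
  exists A; split => // x /= nb K; apply: contrapT => nK; apply: nb.
  exists K%:R => n; rewrite leNgt; apply/negP => Kn; apply: nK.
  by exists n; exact: lt_le_trans (max_sum_ge n x).
exfalso; move: f0; apply/negP; rewrite -leNgt.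
pose D n x := max_sum n.+1 x - max_sum n (th x).
have DE n x : D n x = Num.max (- max_sum n (th x)) (f x).
  by rewrite /D /= addr_maxl sub0r addrK.
have ID n : mu.-integrable setT (EFin \o D n).
  have := integrable_comp thP (integrable_max_sum n).
  by move=> /(integrableB measurableT (integrable_max_sum n.+1)); exact.
have D0 n : (0 <= \int[mu]_x (D n x)%:E)%E.
  rewrite /D; under eq_integral do rewrite EFinB.
  have im := integrable_max_sum.
  rewrite (integralB_EFin measurableT (im _) (integrable_comp thP (im n))).
  rewrite (integral_comp thP (f := EFin \o max_sum n)); last exact: measurable_int (im n).
  rewrite sube_ge0; last by rewrite (integrable_fin_num _ (im n)).
  apply: (le_integral measurableT (im n) (im n.+1)) => x _.
  by rewrite lee_fin max_sum_le.
have [|||||_ _ cv] := @dominated_convergence _ _ _ mu setT measurableT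
    (fun n => EFin \o D n) (EFin \o f) (fun x => `|(f x)%:E|%E).
- by move=> n; exact: measurable_int (ID n).
- exact: measurable_int fi.
- exists (~` A); split; first exact: measurableC.
    have := probability_setC mu mA; rewrite A1 subee// => ->//.
  move=> x /= nx Ax; apply: nx => _; have := Ax.
  rewrite -{1}thA => /(_ (Num.bound `|f x|))[N hN].
  (* D n x = f x as soon as the maximum along the shifted orbit exceeds |f x| *)
  apply: cvg_near_cst; exists N => // n /= Nn; rewrite /= DE; congr EFin.
  apply/max_idPr; rewrite lerNl; apply: le_trans (ler_norm _) _; rewrite normrN.
  rewrite (le_trans (ltW (archi_boundP _)))//.
  by rewrite (le_trans (ltW hN))// max_sum_nd.
- exact: (integrable_norm fi).
- apply: aeW => x n _; rewrite lee_fin DE.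
  have := max_sum_ge0 n (th x); set m := max_sum _ _ => m0.
  rewrite ler_norml le_max ge_max ler_norm andbT.
  have -> : - `|f x| <= f x by rewrite lerNl -normrN ler_norm.
  by rewrite orbT /= (le_trans _ (normr_ge0 _))// oppr_le0.
rewrite -(cvg_lim _ cv)//; apply: lime_ge; first exact: cvgP cv.
by apply: nearW => n; exact: D0.
Qed.

End maximal.

(** Boundedness of the Birkhoff sums of $\pm(f-m)-1/(k+1)$, which have integral
    $-1/(k+1)<0$, bounds the deviation of the averages from [m] by $1/(k+1)$ up
    to $O(1/n)$. *)
Lemma birkhoff (f : T -> R) : mu.-integrable setT (EFin \o f) ->
  {ae mu, forall x,
    n%:R^-1 * (\sum_(i < n) f (iter i th x)) @[n --> \oo]
      --> fine (\int[mu]_x (f x)%:E)%E}.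
Proof.
move=> fi; set m := fine _.
have mE : (\int[mu]_x (f x)%:E)%E = m%:E.
  by rewrite fineK// (integrable_fin_num _ fi).
have ic (c : R) : mu.-integrable setT (EFin \o cst c).
  exact: finite_measure_integrable_cst.
have cE (c : R) : (\int[mu]_x (cst c x)%:E = c%:E)%E.
  rewrite (integral_cst _ measurableT c%:E) [X in (_ * X)%E](_ : _ = 1%E) ?mule1//.
  exact: probability_setT.
have ifm : mu.-integrable setT (EFin \o (fun x => f x - m)).
  exact: (integrableB measurableT fi (ic m)).
have ie (e : R) : mu.-integrable setT (EFin \o (fun x => e * (f x - m))).
  exact: (integrableZl measurableT e ifm).
have sgn (e : R) (k : nat) : {ae mu, forall x, exists K : R, forall n,
    \sum_(i < n) (e * (f (iter i th x) - m) - k.+1%:R^-1) <= K}.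
  apply: (@birkhoff_sum_bounded (fun x => e * (f x - m) - k.+1%:R^-1)).
    exact: (integrableB measurableT (ie e) (ic _)).
  under eq_integral do rewrite EFinB.
  rewrite (integralB_EFin measurableT (ie e) (ic _)).
  under eq_integral do rewrite EFinM.
  rewrite (integralZl measurableT ifm)/=; under eq_integral do rewrite EFinB.
  rewrite (integralB_EFin measurableT fi (ic m)) mE !cE.
  by rewrite subee// mule0 sub0e oppe_lt0 lte_fin invr_gt0.
have /ae_foralln ub k := sgn 1 k.
have /ae_foralln lb k := sgn (-1) k.
have : {ae mu, forall x, (forall k, exists K : R, forall n,
    \sum_(i < n) (1 * (f (iter i th x) - m) - k.+1%:R^-1) <= K) /\
    (forall k, exists K : R, forall n,
    \sum_(i < n) (-1 * (f (iter i th x) - m) - k.+1%:R^-1) <= K)}.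
  by apply: filterS2 ub lb.
apply: filterS => x [{}ub {}lb].
have sumE e n k : \sum_(i < n) (e * (f (iter i th x) - m) - k.+1%:R^-1) =
    e * (\sum_(i < n) f (iter i th x)) - n%:R * (e * m + k.+1%:R^-1).
  under eq_bigr do rewrite mulrBr -addrA -opprD.
  by rewrite big_split/= sumr_const card_ord -mulr_sumr mulNrn mulr_natl.
apply/cvgrPdist_le => e e0.
have [k _ ke] := near_infty_natSinv_lt (PosNum (divr_gt0 e0 (ltr0n _ 2))).
have {}ke := ke k (leqnn _); rewrite /= in ke.
have [K1 hK1] := ub k; have [K2 hK2] := lb k.
near=> n.
have n0 : 0 < n%:R :> R by rewrite ltr0n; near: n; exact: nbhs_infty_gt.
have nK : `|K1| + `|K2| <= n%:R * (e / 2).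
  rewrite -ler_pdivrMr ?divr_gt0//; near: n; exact: nbhs_infty_ger.
have := hK1 n; have := hK2 n; rewrite !sumE.
move: (\sum_(i < n) _) (k.+1%:R^-1) ke => S j je.
have := ler_norm K1; have := ler_norm K2; have := normr_ge0 K1; have := normr_ge0 K2.
move=> a1 a2 a3 a4 h1 h2.
have h3 : n%:R * j <= n%:R * (e / 2) by rewrite ler_wpM2l// ltW.
rewrite -(ler_pM2l n0) -{1}(ger0_norm (ltW n0)) -normrM mulrBr mulrA divff ?gt_eqF//.
rewrite mul1r ler_norml; apply/andP; split; nra.
Unshelve. all: by end_near.
Qed.

End birkhoff.

(** * Simple maps with values in a normed space *)

Section simple_maps.
Context (R : realType) d (T : measurableType d) (P : probability T R).
Implicit Types (V W : normedModType R).

Lemma simple_map_preimage V (s : T -> V) (A : set V) :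
  simple_map s -> measurable (s @^-1` A).
Proof.
move=> [fs ms].
rewrite (_ : s @^-1` A = \bigcup_(v in range s `&` A) (s @^-1` [set v])).
  by apply: fin_bigcup_measurable => [|v _]; [exact: finite_setIl|exact: ms].
apply/seteqP; split => [x Ax|x [v [_ Av]] /= ->//].
by exists (s x) => //; split => //; exists x.
Qed.

(** This replaces joint measurability: on each of the finitely many level sets of
    [s] the first argument of [F] is constant. *)
Lemma measurable_simple_dep V d' (U : measurableType d') (s : T -> V)
    (F : V -> T -> U) : simple_map s ->
  (forall v, measurable_fun setT (F v)) ->
  measurable_fun setT (fun x => F (s x) x).
Proof.
move=> [fs ms] mF _ Y mY; rewrite setTI.
rewrite (_ : _ @^-1` Y =
    \bigcup_(v in range s) (s @^-1` [set v] `&` F v @^-1` Y)).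
  apply: fin_bigcup_measurable => // v _; apply: measurableI; first exact: ms.
  by rewrite -[X in measurable X]setTI; exact: mF.
apply/seteqP; split => [x Yx|x [v _ /= [->]]//].
by exists (s x) => //; exists x.
Qed.

Lemma simple_map2 V1 V2 W (g : V1 -> V2 -> W) (s1 : T -> V1) (s2 : T -> V2) :
  simple_map s1 -> simple_map s2 -> simple_map (fun x => g (s1 x) (s2 x)).
Proof.
move=> S1 S2; split.
  have := finite_image2 g S1.1 S2.1; apply: sub_finite_set => _ [x _ <-].
  by exists (s1 x); [exists x|exists (s2 x) => //; exists x].
move=> w; rewrite -[X in measurable X]setTI.
rewrite (_ : _ `&` _ = setT `&` (fun x => g (s1 x) (s2 x) == w) @^-1` [set true]).
  apply: (@measurable_simple_dep V1 _ bool s1 (fun v x => g v (s2 x) == w)) => //.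
  move=> v _ Y _; rewrite setTI.
  exact: (@simple_map_preimage V2 s2 [set u | Y (g v u == w)]).
by congr (_ `&` _); apply/seteqP; split=> x /= /eqP.
Qed.

Let rg V (s : T -> V) := fset_set (range s).

Let sum_fibre V (s : T -> V) (M : zmodType) (F : V -> M) (x : T) :
  simple_map s -> \sum_(w <- rg s) (if w == s x then F w else 0) = F (s x).
Proof.
move=> [fs _]; rewrite (bigD1_seq (s x)) ?fset_uniq//=; last first.
  by rewrite in_fset_set//; apply/mem_set; exists x.
by rewrite eqxx big1 ?addr0// => w /negbTE ->.
Qed.

(** Change of variables.  It lets two simple maps be integrated over the common
    partition given by the level sets of their pair. *)
Lemma simple_integral_comp V W (s : T -> W) (g : W -> V) : simple_map s ->
  simple_integral P (fun x => g (s x)) =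
  \sum_(w <- rg s) fine (P (s @^-1` [set w])) *: g w.
Proof.
move=> S; have [fs ms] := S; pose gs x := g (s x).
have Sg : simple_map gs by exact: (simple_map2 (fun v _ => g v) S S).
have [fgs _] := Sg; rewrite /simple_integral fsbig_finite//=.
have fP A : measurable A -> P A \is a fin_num.
  by move=> mA; exact: fin_num_measure.
have PE v : fine (P (gs @^-1` [set v])) =
    \sum_(w <- rg s) (if g w == v then fine (P (s @^-1` [set w])) else 0).
  rewrite (_ : _ @^-1` _ = \bigcup_(w in range s `&` g @^-1` [set v]) s @^-1` [set w]).
    rewrite measure_fin_bigcup//; last 2 first.
    - exact: finite_setIl.
    - by move=> w1 w2 _ _ [x [/= <- <-]].
    rewrite fsbig_mkcondr fsbig_finite//= big_seq.
    rewrite (eq_bigr (fun w =>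
        (if g w == v then fine (P (s @^-1` [set w])) else 0)%:E)).
      by rewrite sumEFin/= -big_seq.
    move=> w _; rewrite (_ : (w \in _) = (g w == v)).
      by case: ifP => // _; rewrite fineK// fP.
    by apply/idP/eqP => [/set_mem//|gw]; exact: mem_set.
  apply/seteqP; split => [x gx|x [w [_ /= gv] /= sx]]; last first.
    by rewrite /gs sx.
  by exists (s x) => //; split => //; exists x.
under eq_bigr do rewrite PE scaler_suml.
rewrite exchange_big/= big_seq [RHS]big_seq; apply: eq_bigr => w.
rewrite in_fset_set// => /set_mem[x _ <-].
rewrite -(sum_fibre (fun v => fine (P (s @^-1` [set s x])) *: v) x Sg).
by apply: eq_bigr => v _; rewrite eq_sym; case: eqP; rewrite ?scale0r.
Qed.

Lemma integral_simple_comp V (s : T -> V) (G : V -> R) : simple_map s ->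
  (forall v, 0 <= G v) ->
  (\int[P]_x (G (s x))%:E)%E =
  (\sum_(v <- rg s) fine (P (s @^-1` [set v])) * G v)%:E.
Proof.
move=> S G0; have [fs ms] := S.
transitivity (\int[P]_x (\sum_(v <- rg s) (G v)%:E * (\1_(s @^-1` [set v]) x)%:E))%E.
  apply: eq_integral => x _.
  rewrite -(sum_fibre G x S) -sumEFin; apply: eq_bigr => v _.
  rewrite indicE -EFinM; case: eqP => [->|vx]; first by rewrite mem_set ?mulr1.
  by rewrite memNset ?mulr0//= => /esym.
rewrite ge0_integral_sum//; last 2 first.
- by move=> v; apply: measurable_funeM; apply/measurable_EFinP; exact: measurable_indic.
- by move=> v x _; rewrite mule_ge0// lee_fin.
rewrite -sumEFin; apply: eq_bigr => v _.
rewrite ge0_integralZl//; last 2 first.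
- by apply/measurable_EFinP; exact: measurable_indic.
- by rewrite lee_fin.
by rewrite integral_indic// setIT EFinM muleC fineK// fin_num_measure.
Qed.

Lemma simple_integral_dist V (s s' : T -> V) : simple_map s -> simple_map s' ->
  (`|simple_integral P s - simple_integral P s'|%:E <=
   \int[P]_x `|s x - s' x|%:E)%E.
Proof.
move=> S S'; pose p x := (s x, s' x).
have Sp : simple_map p by exact: (simple_map2 (fun v w => (v, w)) S S').
rewrite (simple_integral_comp (fun w : V * V => w.1) Sp).
rewrite (simple_integral_comp (fun w : V * V => w.2) Sp).
rewrite (integral_simple_comp (G := fun w : V * V => `|w.1 - w.2|) Sp)// lee_fin.
rewrite -sumrB (le_trans (ler_norm_sum _ _ _))//; apply: ler_sum => w _.
by rewrite -scalerBr normrZ ger0_norm// fine_ge0.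
Qed.

End simple_maps.

(** * The Bochner integral and the vector-valued ergodic theorem *)

Lemma cvge0_near_lt (R : realType) (u : nat -> \bar R) (e : R) :
  u @ \oo --> 0%E -> 0 < e -> \forall n \near \oo, (u n < e%:E)%E.
Proof.
move=> u0 e0; apply: (u0 [set y | (y < e%:E)%E]).
by apply: open_nbhs_nbhs; split; [exact: open_ereal_lt_ereal|rewrite /= lte_fin].
Qed.

Section bochner_integrals.
Context (R : realType) d (T : measurableType d) (P : probability T R).
Context (V : normedModType R).
Implicit Types (f s : T -> V) (I J : V).

(** For maps into a separable space this is Borel measurability; it is the only
    form of measurability that integrals of norms require, and it avoids a
    sigma-algebra on [V]. *)
Definition dist_measurable f :=
  forall v, measurable_fun setT (fun x => `|f x - v|).

Lemma dist_measurable_norm f : dist_measurable f ->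
  measurable_fun setT (fun x => `|f x|).
Proof. by move=> /(_ 0); under eq_fun do rewrite subr0. Qed.

Lemma measurable_dist_simple f s : dist_measurable f -> simple_map s ->
  measurable_fun setT (fun x => `|f x - s x|%:E).
Proof.
move=> mf ms; apply/measurable_EFinP.
exact: (measurable_simple_dep (F := fun v x => `|f x - v|) ms).
Qed.

Lemma simple_integral_approx f s s' : dist_measurable f ->
  simple_map s -> simple_map s' ->
  (`|simple_integral P s - simple_integral P s'|%:E <=
   \int[P]_x `|f x - s x|%:E + \int[P]_x `|f x - s' x|%:E)%E.
Proof.
move=> mf ms ms'; apply: le_trans (simple_integral_dist P ms ms') _.
rewrite -ge0_integralD//; last 2 first.
- exact: measurable_dist_simple.
- exact: measurable_dist_simple.
apply: ge0_le_integral => //.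
- apply/measurable_EFinP.
  apply: (@measurable_simple_dep _ _ _ V _ _ s (fun v x => `|v - s' x|)) => // v.
  exact: (@measurable_simple_dep _ _ _ V _ _ s' (fun w x => `|v - w|)).
- by apply: emeasurable_funD; exact: measurable_dist_simple.
move=> x _; rewrite -EFinD lee_fin.
have -> : s x - s' x = (f x - s' x) - (f x - s x) by rewrite opprB [RHS]addrC subrKA.
by rewrite (le_trans (ler_normB _ _))// [leLHS]addrC.
Qed.

(** Measurability of the distances makes their integrals subadditive, so that the
    simple integrals of any two approximating sequences come together. *)
Lemma has_bochner_integral_unique f I J : dist_measurable f ->
  has_bochner_integral P f I -> has_bochner_integral P f J -> I = J.
Proof.
move=> mf [s [ms _ s0 sI]] [s' [ms' _ s'0 s'J]].
apply/eqP; rewrite -subr_eq0 -normr_eq0 eq_le normr_ge0 andbT -lee_fin.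
have cl : (`|simple_integral P (s n) - simple_integral P (s' n)|%:E
    @[n --> \oo] --> `|I - J|%:E)%E.
  by apply: cvg_EFin; [exact: nearW|apply: cvg_norm; exact: cvgB].
have cr : ((\int[P]_x `|f x - s n x|%:E + \int[P]_x `|f x - s' n x|%:E)
    @[n --> \oo] --> 0 + 0)%E by exact: cvgeD.
rewrite -(cvg_lim _ cl)// -[X in (_ <= X)%E]add0e -(cvg_lim _ cr)//.
apply: lee_lim; [exact: (cvgP _ cl)|exact: (cvgP _ cr)|].
by apply: nearW => n; exact: simple_integral_approx.
Qed.

(** The simple integrals form a Cauchy sequence by [simple_integral_approx];
    completeness is a hypothesis because [V] ranges over normed spaces. *)
Lemma has_bochner_integral_exists f (s : nat -> T -> V) :
  (forall u : nat -> V, cauchy (u @ \oo) -> cvg (u @ \oo)) ->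
  dist_measurable f -> (forall n, simple_map (s n)) ->
  (forall x, s n x @[n --> \oo] --> f x) ->
  (\int[P]_x `|f x - s n x|%:E @[n --> \oo] --> 0)%E ->
  exists I, has_bochner_integral P f I.
Proof.
move=> Vcomplete mf ms sf s0.
suff /Vcomplete/cvg_ex[I sI] : cauchy (simple_integral P (s n) @[n --> \oo]).
  by exists I, s; split => //; exact: aeW.
apply: cauchy_exP => e e0.
have [N _ hN] : \forall n \near \oo, (\int[P]_x `|f x - s n x|%:E < (e / 2)%:E)%E.
  by apply: cvge0_near_lt s0 _; rewrite divr_gt0.
exists (simple_integral P (s N)), N => // n /= Nn.
rewrite -ball_normE/= -lte_fin.
apply: le_lt_trans (simple_integral_approx mf (ms N) (ms n)) _.
by rewrite [e in e%:E]splitr EFinD lteD//; [exact: (hN N (leqnn _))|exact: hN].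
Qed.

End bochner_integrals.

Section bochner_comp.
Context (R : realType) d1 d2 (T1 : measurableType d1) (T2 : measurableType d2).
Context (P1 : probability T1 R) (P2 : probability T2 R) (g : T1 -> T2).
Context (V : normedModType R).

Lemma has_bochner_integral_comp (f : T2 -> V) (I : V) :
  measure_preserving P1 P2 g -> dist_measurable f ->
  has_bochner_integral P2 f I -> has_bochner_integral P1 (f \o g) I.
Proof.
move=> gP mf [s [ms sf s0 sI]]; have [mg gmu] := gP.
have rsg n : range (s n \o g) `<=` range (s n) by move=> _ [x _ <-]; exists (g x).
exists (fun n => s n \o g); split.
- move=> n; have [fs msn] := ms n; split; first exact: sub_finite_set (rsg n) fs.
  by move=> v; rewrite -[X in measurable X]setTI; exact: mg (msn v).
- exact: (ae_comp gP sf).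
- apply: cvg_trans s0; apply: near_eq_cvg; apply: nearW => n /=.
  rewrite -(ge0_integral_comp gP (f := fun y => `|f y - s n y|%:E))//.
  exact: measurable_dist_simple.
- apply: cvg_trans sI; apply: near_eq_cvg; apply: nearW => n /=.
  (* values of s n outside the image of g have null level sets *)
  rewrite /simple_integral [RHS](fsbig_widen _ _ _ (rsg n)).
    by apply: eq_fsbigr => v _; rewrite -gmu//; exact: (ms n).2.
  move=> v [/= _ nv]; rewrite (_ : _ @^-1` _ = set0) ?measure0 ?scale0r//.
  by apply/seteqP; split => // x /= sx; apply: nv; exists x.
Qed.

End bochner_comp.

Section vector_birkhoff.
Context (R : realType) d (T : measurableType d) (mu : probability T R).
Context (th : T -> T) (thP : measure_preserving mu mu th).
Hypothesis erg : forall M, measurable M -> th @^-1` M = M ->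
  mu M = 0%E \/ mu M = 1%E.
Context (V : normedModType R).

Let avg (f : T -> V) n x := n%:R^-1 *: \sum_(i < n) f (iter i th x).

(** A simple map is a linear combination of indicators, to each of which the
    scalar theorem applies. *)
Let birkhoff_simple (s : T -> V) : simple_map s ->
  {ae mu, forall x, avg s n x @[n --> \oo] --> simple_integral mu s}.
Proof.
move=> ms; have [fs msv] := ms.
pose r := fset_set (range s).
rewrite (simple_integral_comp mu id ms) -/r.
have sE x : s x = \sum_(v <- r) \1_(s @^-1` [set v]) x *: v.
  rewrite (bigD1_seq (s x)) ?fset_uniq//=; last first.
    by rewrite in_fset_set//; apply/mem_set; exists x.
  rewrite indicE mem_set// scale1r big1 ?addr0// => v vx.
  by rewrite indicE memNset ?scale0r//= => sv; rewrite sv eqxx in vx.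
have {}sE n x : avg s n x = \sum_(v <- r)
    (n%:R^-1 * \sum_(i < n) \1_(s @^-1` [set v]) (iter i th x)) *: v.
  rewrite /avg; under eq_bigr do rewrite sE.
  rewrite exchange_big/= scaler_sumr; apply: eq_bigr => v _.
  by rewrite -scaler_suml scalerA.
suff : {ae mu, forall x, \sum_(v <- r)
    (n%:R^-1 * \sum_(i < n) \1_(s @^-1` [set v]) (iter i th x)) *: v @[n --> \oo]
    --> \sum_(v <- r) fine (mu (s @^-1` [set v])) *: v}.
  apply: filterS => x; apply: cvg_trans; apply: near_eq_cvg.
  by apply: nearW => n; rewrite sE.
elim: {sE}(r : seq V) => [|v l IH].
  by apply: aeW => x; rewrite big_nil; under eq_fun do rewrite big_nil; exact: cvg_cst.
have := @birkhoff _ _ _ _ _ thP erg _ (integrable_indic mu (msv v)).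
rewrite integral_indic// setIT; apply: filterS2 IH => x IH hv.
rewrite big_cons; under eq_fun do rewrite big_cons.
by apply: cvgD => //; exact: cvgZr_tmp.
Qed.

(** The averages of [f] and of a simple map [s k] differ by at most the average of
    their distance, which converges to the integral [a k] of that distance. *)
Lemma bochner_birkhoff (f : T -> V) (I : V) : dist_measurable f ->
  has_bochner_integral mu f I ->
  {ae mu, forall x, n%:R^-1 *: \sum_(i < n) f (iter i th x) @[n --> \oo] --> I}.
Proof.
move=> mf [s [ms _ s0 sI]].
pose a k := (\int[mu]_x `|f x - s k x|%:E)%E.
have dist_avg k : {ae mu, forall x, (a k < +oo)%E ->
    n%:R^-1 * \sum_(i < n) `|f (iter i th x) - s k (iter i th x)| @[n --> \oo]
      --> fine (a k)}.
  have [ak|ak] := ltP (a k) +oo%E; last exact: aeW.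
  have : mu.-integrable setT (EFin \o (fun x => `|f x - s k x|)).
    apply/integrableP; split; first exact: measurable_dist_simple.
    by under eq_integral do rewrite /= normr_id.
  by move=> /(birkhoff thP erg); apply: filterS.
have := ae_foralln dist_avg.
have := ae_foralln (fun k => birkhoff_simple (ms k)).
apply: filterS2 => x sx dx.
apply/cvgrPdist_le => e e0.
have e4 : 0 < e / 4 by rewrite divr_gt0.
have [k [ak sk]] : exists k, (a k < (e / 4)%:E)%E /\
    `|I - simple_integral mu (s k)| <= e / 4.
  near \oo => k; exists k; split; near: k.
    exact: cvge0_near_lt s0 _.
  by move/cvgrPdist_le : sI; exact.
have akoo : (a k < +oo)%E by exact: lt_trans ak (ltry _).
have a0 : (0 <= a k)%E by apply: integral_ge0 => y _.
have fak : fine (a k) < e / 4 by rewrite -lte_fin fineK// ge0_fin_numE.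
have /cvgrPdist_le/(_ _ e4) dk := dx k akoo.
have /cvgrPdist_le/(_ _ e4) sxk := sx k.
near=> n.
have h1 : `|fine (a k) -
    n%:R^-1 * \sum_(i < n) `|f (iter i th x) - s k (iter i th x)| | <= e / 4.
  by near: n.
have h2 : `|simple_integral mu (s k) - avg (s k) n x| <= e / 4 by near: n.
have h3 : `|avg (s k) n x - n%:R^-1 *: \sum_(i < n) f (iter i th x)| <=
    n%:R^-1 * \sum_(i < n) `|f (iter i th x) - s k (iter i th x)|.
  rewrite distrC /avg -scalerBr normrZ ger0_norm ?invr_ge0//.
  by rewrite ler_wpM2l ?invr_ge0// -sumrB ler_norm_sum.
have := ler_distD (simple_integral mu (s k)) I
  (n%:R^-1 *: \sum_(i < n) f (iter i th x)).
have := ler_distD (avg (s k) n x) (simple_integral mu (s k))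
  (n%:R^-1 *: \sum_(i < n) f (iter i th x)).
move: h1; rewrite ler_norml => /andP[h1 _]; lra.
Unshelve. all: by end_near.
Qed.

End vector_birkhoff.

(** * The shift on the space of trajectories *)

Section path_space.
Context (E : ptopologicalType).

Definition path_space := g_sigma_algebraType (\bigcup_(i in [set: int])
  preimage_set_system setT (fun x : int -> borel E => x i) measurable).

HB.instance Definition _ := Measurable.on path_space.

Lemma measurable_coord (i : int) :
  measurable_fun [set: path_space] (fun x : path_space => x i : borel E).
Proof.
move=> _ Y mY; apply: sub_sigma_algebra; exists i => //.
by exists Y.
Qed.

(** The sigma-algebra of [path_space] is generated by the coordinates. *)
Lemma measurable_path d (T : measurableType d) (f : T -> path_space) :
  (forall i, measurable_fun setT (fun x => f x i : borel E)) ->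
  measurable_fun setT f.
Proof.
move=> mf; apply: measurability => // _ [_ [i _ [Y mY <-]] <-].
by rewrite !setTI; have := mf i measurableT _ mY; rewrite setTI.
Qed.

Lemma measurable_shift :
  measurable_fun setT (@Defs.shift E : path_space -> path_space).
Proof. by apply: measurable_path => i; exact: measurable_coord. Qed.

Lemma iter_shift n (x : int -> E) (j : int) :
  iter n (@Defs.shift E) x j = x (j + n%:Z).
Proof.
elim: n j => [|n IH] j; first by rewrite /= addr0.
by rewrite iterS /Defs.shift IH -addrA -intS.
Qed.

End path_space.

Section path_law.
Context (R : realType) d (Omega : measurableType d) (P : probability Omega R).
Context (E : ptopologicalType) (X : int -> {mfun Omega >-> borel E}).

Definition trajectory (w : Omega) : path_space E := fun t => X t w.

Lemma measurable_trajectory : measurable_fun setT trajectory.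
Proof. by apply: measurable_path => i; exact: measurable_funP. Qed.

HB.instance Definition _ := isMeasurableFun.Build _ _ _ _ _ measurable_trajectory.

Definition path_law : probability (path_space E) R := distribution P trajectory.

Lemma trajectory_preserving : measure_preserving P path_law trajectory.
Proof. by split; first exact: measurable_trajectory. Qed.

Let cyl (l : seq (int * set E)) : set (path_space E) :=
  [set x | forall p, p \in l -> p.2 (x p.1)].

Let cylinders := [set M | exists2 l : seq (int * set E),
  (forall p, p \in l -> measurable (p.2 : set (borel E))) & M = cyl l].

Let measurable_cyl l :
  (forall p, p \in l -> measurable (p.2 : set (borel E))) -> measurable (cyl l).
Proof.
move=> ml; rewrite (_ : cyl l = \bigcap_(p in [set` l])
    (fun x : path_space E => x p.1) @^-1` p.2).
  apply: fin_bigcap_measurable => // p /= pl.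
  rewrite -[X in measurable X]setTI.
  exact: (@measurable_coord E p.1 measurableT p.2 (ml p pl)).
by apply/seteqP; split => x h p pl; exact: h.
Qed.

Let cylindersE : measurable = <<s cylinders >> :> set (set (path_space E)).
Proof.
apply/seteqP; split.
  apply: smallest_sub; first exact: smallest_sigma_algebra.
  move=> _ [i _ [Y mY <-]]; apply: sub_sigma_algebra.
  exists [:: (i, Y)]; first by move=> p; rewrite inE => /eqP ->.
  apply/seteqP; split => x /=; first by move=> [_ Yx] p; rewrite inE => /eqP ->.
  by move=> h; split => //; apply: (h (i, Y)); rewrite inE.
apply: smallest_sub; first exact: sigma_algebra_measurable.
by move=> _ [l ml ->]; exact: measurable_cyl.
Qed.

Hypothesis stat : stationary P X.

(** A cylinder is an event on the joint law of finitely many coordinates, to which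
    stationarity with time shift $1$ applies. *)
Let shift_cyl l : (forall p, p \in l -> measurable (p.2 : set (borel E))) ->
  path_law (@Defs.shift E @^-1` cyl l) = path_law (cyl l).
Proof.
move=> ml; pose r := size l.
pose t : r.-tuple int := [tuple (tnth (in_tuple l) i).1 | i < r].
pose A : set (r.-tuple (borel E)) :=
  \bigcap_(i in [set: 'I_r]) (fun y => tnth y i) @^-1` (tnth (in_tuple l) i).2.
have mA : measurable A.
  apply: fin_bigcap_measurable => // i _; rewrite -[X in measurable X]setTI.
  by apply: measurable_tnth => //; apply: ml; exact: mem_tnth.
have := stat t 1 mA; rewrite /pushforward.
rewrite (_ : joint X t @^-1` A = trajectory @^-1` cyl l); last first.
  apply/seteqP; split => w h.
    move=> p /(tnthP (in_tuple l))[i ->].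
    by have := h i I; rewrite /joint /= !tnth_mktuple.
  by move=> i _; rewrite /= /joint !tnth_mktuple; apply: h; exact: mem_tnth.
rewrite (_ : joint X _ @^-1` A = trajectory @^-1` (@Defs.shift E @^-1` cyl l))//.
apply/seteqP; split => w h.
  move=> p /(tnthP (in_tuple l))[i ->].
  by have := h i I; rewrite /joint /= !tnth_mktuple.
move=> i _; rewrite /= /joint !tnth_mktuple.
by apply: (h (tnth (in_tuple l) i)); exact: mem_tnth.
Qed.

(** Cylinders are stable under intersection and generate the sigma-algebra, so
    that they determine the law. *)
Lemma shift_preserving : measure_preserving path_law path_law (@Defs.shift E).
Proof.
split; first exact: measurable_shift.
move=> A mA; have ms := @measurable_shift E.
pose msm := isMeasurableFun.Build _ _ _ _ _ ms.
pose sh : {mfun path_space E >-> path_space E} := HB.pack (@Defs.shift E) msm.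
apply: (@measure_unique _ _ _ cylinders (fun=> setT) cylindersE _ _ _
  (distribution path_law sh) path_law) => //.
- move=> _ _ [l ml ->] [k mk ->]; exists (l ++ k).
    by move=> p; rewrite mem_cat => /orP[/ml|/mk].
  apply/seteqP; split => x.
    by move=> [xl xk] p; rewrite mem_cat => /orP[/xl|/xk].
  by move=> h; split => p pl; apply: h; rewrite mem_cat pl ?orbT.
- by move=> _; exists [::] => //; apply/seteqP; split.
- by rewrite bigcup_const//.
- by move=> _ [l ml ->]; exact: shift_cyl.
- by move=> _; rewrite [X in (X < _)%E]probability_setT ltry.
Qed.

Lemma path_ergodic : ergodic P X -> forall M : set (path_space E),
  measurable M -> @Defs.shift E @^-1` M = M ->
  path_law M = 0%E \/ path_law M = 1%E.
Proof. by move=> erg M mM sM; exact: (erg M mM sM). Qed.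

End path_law.

(** * Completeness of the space of Hilbert--Schmidt operators *)

Lemma cauchy_seq_dist (R : realType) (V : normedModType R) (u : nat -> V) (e : R) :
  cauchy (u @ \oo) -> 0 < e ->
  exists N, forall m n, (N <= m)%N -> (N <= n)%N -> `|u m - u n| < e.
Proof.
move=> /cauchy_ballP uc e0; have [[A B] [/= [NA _ hA] [NB _ hB]] h] := uc _ e0.
exists (maxn NA NB) => m n; rewrite !geq_max => /andP[mA _] /andP[_ nB].
have := h (u m, u n) (conj (hA m mA) (hB n nB)).
by rewrite /= -ball_normE.
Qed.

Section S2_complete.
Context (R : realType) (H : hilbertType R).

Lemma S2_linear (A : S2 H) : linear A.
Proof. by have [] := S2_bounded A. Qed.

Lemma S2_0 (A : S2 H) : A 0 = 0.
Proof. 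
have := S2_linear A 1 0 0; rewrite !scale1r addr0 -[LHS]addr0.
by move/addrI.
Qed.

Lemma S2_sum (A : S2 H) (s : seq H) (c : H -> R) :
  A (\sum_(e <- s) c e *: e) = \sum_(e <- s) c e *: A e.
Proof.
elim: s => [|e s IH]; first by rewrite !big_nil S2_0.
by rewrite !big_cons S2_linear IH.
Qed.

Lemma S2_sub (A : S2 H) x y : A (x - y) = A x - A y.
Proof. by have := S2_linear A (-1) y x; rewrite !scaleN1r !(addrC (- _)). Qed.

(** The difference of [x] and its expansion lies in the span of [u] and is
    orthogonal to [u], hence to itself. *)
Lemma lspan_expansion (B : set H) (x : H) : Defs.orthonormal B -> lspan B x ->
  exists u : seq H, [/\ uniq u, forall e, e \in u -> B e &
    x = \sum_(e <- u) inner e x *: e].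
Proof.
move=> oB [s [c [sB xE]]]; pose u := undup s.
have uu : uniq u by exact: undup_uniq.
have uB e : e \in u -> B e by rewrite mem_undup; exact: sB.
exists u; split => //.
pose p := \sum_(e <- u) inner e x *: e.
have de e : e \in u -> inner e (x - p) = 0.
  move=> eu; rewrite innerDr innerNr [inner e p]innerC inner_suml.
  rewrite (bigD1_seq e)//= innerZl (oB _ _ (uB _ eu) (uB _ eu)) eqxx mulr1.
  rewrite big_seq_cond big1 ?addr0 ?subrr// => f /andP[fu fe].
  by rewrite innerZl (oB _ _ (uB _ fu) (uB _ eu)) (negbTE fe) mulr0.
have d0 (r : seq H) (a : H -> R) : {subset r <= u} ->
    inner (\sum_(e <- r) a e *: e) (x - p) = 0.
  move=> ru; rewrite inner_suml big_seq big1// => e er.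
  by rewrite innerZl de ?mulr0//; exact: ru.
apply/eqP; rewrite -subr_eq0 -normr_eq0 -sqrf_eq0 -inner_norm.
rewrite -/p innerDl innerNl d0// subr0 {1}xE d0// => e.
by rewrite mem_undup.
Qed.

Lemma S2_sum_le (A : S2 H) (u : seq H) :
  uniq u -> (forall e, e \in u -> hbasis H e) ->
  \sum_(e <- u) `|A e| ^+ 2 <= `|A| ^+ 2.
Proof.
move=> uu uB; rewrite -lee_fin.
have -> : (`|A| ^+ 2)%:E = hs_sqnorm A by rewrite S2_sqnorm.
apply: esum_ge; exists [set` u]; first by split => //; exact: finite_seq.
by rewrite -sumEFin fsbig_seq.
Qed.

(** The operator norm is at most the Hilbert--Schmidt norm: on the span of the
    basis by expanding [x], Cauchy--Schwarz and Bessel, and everywhere by density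
    and boundedness. *)
Lemma S2_opnorm (A : S2 H) x : `|A x| <= `|A| * `|x|.
Proof.
have [oB Bdense] := hbasisP H.
have onspan y : lspan (hbasis H) y -> `|A y| <= `|A| * `|y|.
  have [->|A0] := eqVneq A 0; first by rewrite [leLHS]normr0 mulr_ge0.
  have [->|y0] := eqVneq y 0; first by rewrite S2_0 normr0 mulr0.
  move=> /(lspan_expansion oB)[u [uu uB yE]].
  have By : \sum_(e <- u) inner e y ^+ 2 <= `|y| ^+ 2.
    by apply: bessel => // e f /= /uB eB /uB fB; exact: oB.
  have BA := S2_sum_le A uu uB.
  have nA : 0 < `|A| by rewrite normr_gt0.
  have ny : 0 < `|y| by rewrite normr_gt0.
  (* Cauchy--Schwarz through a b <= (t a^2 + b^2 / t) / 2, with the optimal t *)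
  pose t := `|A| / `|y|.
  have t0 : 0 < t by rewrite divr_gt0.
  have -> : `|A| * `|y| = 2^-1 * (t * `|y| ^+ 2 + t^-1 * `|A| ^+ 2).
    by rewrite /t; field; rewrite !gt_eqF.
  rewrite {1}yE S2_sum (le_trans (ler_norm_sum _ _ _))//.
  apply: (@le_trans _ _ (\sum_(e <- u)
      2^-1 * (t * inner e y ^+ 2 + t^-1 * `|A e| ^+ 2))).
    apply: ler_sum => e _; rewrite normrZ.
    rewrite -(real_normK (num_real (inner e y))).
    move: `|inner e y| `|A e| => a b; rewrite -subr_ge0.
    have -> : 2^-1 * (t * a ^+ 2 + t^-1 * b ^+ 2) - a * b =
        2^-1 * t * (a - t^-1 * b) ^+ 2 by field; rewrite gt_eqF.
    by rewrite mulr_ge0 ?sqr_ge0// mulr_ge0// ltW.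
  rewrite -mulr_sumr big_split/= -!mulr_sumr ler_wpM2l//.
  by rewrite lerD// ler_wpM2l// ?invr_ge0 ltW.
have [_ [M Mb]] := S2_bounded A.
apply/ler_addgt0Pr => e e0.
pose k := `|A| + `|M| + 1.
have k0 : 0 < k by rewrite ltr_wpDl// addr_ge0.
have [||y [xy Sy]] := Bdense (ball x (e / k)).
- by exists x; apply: ballxx; rewrite divr_gt0.
- exact: ball_open.
move: xy; rewrite -ball_normE/= ltr_pdivlMr// => xy.
have -> : A x = A y + A (x - y) by rewrite S2_sub addrC subrK.
rewrite (le_trans (ler_normD _ _))//.
have h1 : `|A (x - y)| <= `|M| * `|x - y|.
  by rewrite (le_trans (Mb _))// ler_wpM2r// ler_norm.
have h2 := onspan y Sy.
have h3 : `|y| <= `|x| + `|x - y|.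
  have {1}-> : y = x - (x - y) by rewrite opprB addrC subrK.
  exact: ler_normB.
have h4 : `|A| * `|y| <= `|A| * `|x| + `|A| * `|x - y|.
  by rewrite -mulrDr ler_wpM2l.
by move: xy; rewrite /k !mulrDr mulr1 => xy; have := normr_ge0 (x - y); lra.
Qed.

(** The limit is taken pointwise.  For [n] beyond a Cauchy index, each finite
    partial sum of the squared Hilbert--Schmidt norm of [L - u n] is a limit of
    sums bounded by $e^2$, which shows both that [L] is Hilbert--Schmidt and that
    [u n] converges to it in norm. *)
Lemma S2_complete (u : nat -> S2 H) : cauchy (u @ \oo) -> cvg (u @ \oo).
Proof.
move=> uc.
have ucx x : cvg (u n x @[n --> \oo]).
  apply: cauchy_cvg; apply: cauchy_exP => e e0.
  have x1 : 0 < `|x| + 1 by rewrite ltr_wpDl.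
  have [N hN] := cauchy_seq_dist uc (divr_gt0 e0 x1).
  exists (u N x), N => // n /= Nn; rewrite -ball_normE/=.
  apply: le_lt_trans (S2_opnorm (u N - u n) x) _.
  have := hN _ _ (leqnn N) Nn; rewrite ltr_pdivlMr//.
  by apply: le_lt_trans; rewrite ler_wpM2l// lerDl.
pose L x := lim (u n x @[n --> \oo]).
have uL x : u n x @[n --> \oo] --> L x by exact: ucx.
have lL : linear L.
  move=> a x y; apply/cvg_lim => //.
  under eq_fun do rewrite S2_linear.
  by apply: cvgD => //; exact: cvgZl_tmp.
have distL N e x : (forall m n, (N <= m)%N -> (N <= n)%N -> `|u m - u n| < e) ->
    forall n, (N <= n)%N -> `|L x - u n x| <= e * `|x|.
  move=> hN n Nn.
  have cv : `|u m x - u n x| @[m --> \oo] --> `|L x - u n x|.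
    by apply: cvg_norm; apply: cvgB => //; exact: cvg_cst.
  rewrite -(cvg_lim _ cv)//; apply: limr_le; first exact: (cvgP _ cv).
  exists N => // m /= Nm; apply: le_trans (S2_opnorm (u m - u n) x) _.
  by rewrite ler_wpM2r// ltW// hN.
have hsL N (e : R) : (forall m n, (N <= m)%N -> (N <= n)%N -> `|u m - u n| < e) ->
    forall n, (N <= n)%N -> (hs_sqnorm (L - u n)%R <= (e ^+ 2)%:E)%E.
  move=> hN n Nn; apply: ge_ereal_sup => _ [F [finF FB] <-].
  rewrite fsbig_finite//= sumEFin lee_fin.
  have cv : \sum_(e <- fset_set F) `|u m e - u n e| ^+ 2 @[m --> \oo] -->
      \sum_(e <- fset_set F) `|L e - u n e| ^+ 2.
    apply: cvg_big => [|e' _]; first exact: add_continuous.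
    under eq_fun do rewrite expr2.
    rewrite expr2; have cd : `|u m e' - u n e'| @[m --> \oo] --> `|L e' - u n e'|.
      by apply: cvg_norm; apply: cvgB => //; exact: cvg_cst.
    exact: cvgM.
  rewrite -(cvg_lim _ cv)//; apply: limr_le; first exact: (cvgP _ cv).
  exists N => // m /= Nm.
  apply: (@le_trans _ _ (`|u m - u n| ^+ 2)).
    apply: (S2_sum_le (u m - u n) (fset_uniq _)) => x.
    by rewrite in_fset_set// => /set_mem/FB.
  by rewrite ler_pXn2r ?nnegrE// ?ltW ?hN// (le_lt_trans _ (hN _ _ Nm Nn)).
have LHS N e : (forall m n, (N <= m)%N -> (N <= n)%N -> `|u m - u n| < e) ->
    (L - u N)%R \in @hilbert_schmidt R H.
  move=> hN; apply/asboolP; split.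
    split.
      have E z : (L - u N)%R z = L z - u N z by [].
      by move=> a x y; rewrite !E lL S2_linear scalerBr opprD addrACA.
    by exists e => x; exact: (distL N e x hN).
  by rewrite (le_lt_trans (hsL N e hN N _))// ltry.
have [N hN] := cauchy_seq_dist uc (@ltr01 R).
have LS : L \in @hilbert_schmidt R H.
  have -> : L = (L - u N) + u N by rewrite subrK.
  apply: rpredD; [exact: LHS hN|exact: S2_opP].
apply/cvg_ex; exists (MkS2 LS); apply/cvgrPdist_le => e e0.
have [N' hN'] := cauchy_seq_dist uc e0.
exists N' => // n /= Nn.
rewrite -(@ler_pXn2r _ 2) ?nnegrE ?normr_ge0 ?(ltW e0)//.
have := hsL N' e hN' n Nn.
have -> : hs_sqnorm (L - u n)%R = (`|MkS2 LS - u n| ^+ 2)%:E.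
  by rewrite -[RHS]S2_sqnorm.
by rewrite lee_fin.
Qed.

End S2_complete.

(** * Bochner integrability of tensor products *)

Section simple_approximation.
Context (R : realType) d (T : measurableType d).

Lemma simple_map_if (V : normedModType R) (B : set T) (s1 s2 : T -> V) :
  measurable B -> simple_map s1 -> simple_map s2 ->
  simple_map (fun x => if x \in B then s1 x else s2 x).
Proof.
move=> mB [f1 m1] [f2 m2]; split.
  have f12 : finite_set (range s1 `|` range s2) by rewrite finite_setU.
  apply: sub_finite_set f12 => _ [x _ <-].
  by case: ifP => _; [left|right]; exists x.
move=> v; rewrite (_ : _ @^-1` _ =
    (B `&` s1 @^-1` [set v]) `|` (~` B `&` s2 @^-1` [set v])).
  by apply: measurableU; apply: measurableI => //; exact: measurableC.
apply/seteqP; split => x /=.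
  by case: ifPn => [/set_mem xB <-|/negP xB <-]; [left|right; split => // /mem_set].
by move=> [[xB <-]|[xB <-]]; [rewrite mem_set|rewrite memNset].
Qed.

Lemma simple_map_cst (V : normedModType R) (c : V) : simple_map (fun _ : T => c).
Proof.
split; first by apply: sub_finite_set (finite_set1 c) => _ [x _ <-].
by move=> v; rewrite preimage_cst; case: ifP.
Qed.

(** [s n] follows the closest of [0] and the first [n] points of a dense sequence.
    Starting from [0] gives the domination by [|f x|]. *)
Lemma simple_approx (V : normedModType R) (f : T -> V) :
  Defs.separable V -> dist_measurable f ->
  exists s : nat -> T -> V, [/\ forall n, simple_map (s n),
    forall x, s n x @[n --> \oo] --> f x &
    forall n x, `|f x - s n x| <= `|f x| ].
Proof.
move=> [D /countable_injP[h hinj] Ddense] mf.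
pose g n := xget (0 : V) [set y | D y /\ h y = n].
have gD y : D y -> g (h y) = y.
  move=> Dy; rewrite /g; case: xgetP => [z _ [Dz hz]|/(_ y)[]//].
  by apply: hinj => //; exact: mem_set.
pose s := fix s n x := if n is m.+1 then
  if x \in [set x | `|f x - g m| < `|f x - s m x|] then g m else s m x else 0.
have sS n : simple_map (s n).
  elim: n => [|n IH]; first exact: simple_map_cst.
  apply: simple_map_if => //; last exact: simple_map_cst.
  have := measurable_fun_ltr (mf (g n))
    (measurable_simple_dep (F := fun v x => `|f x - v|) IH mf).
  by move=> /(_ measurableT [set true] I); rewrite setTI; exact.
have sle m n x : (m <= n)%N -> `|f x - s n x| <= `|f x - s m x|.
  have : nonincreasing_seq (fun n => `|f x - s n x|).
    apply/nonincreasing_seqP => k /=; case: ifPn => // /set_mem/ltW//.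
  by apply.
have sg n x : `|f x - s n.+1 x| <= `|f x - g n|.
  rewrite /=; case: ifPn => // /negP nlt; rewrite leNgt; apply/negP => lt.
  by apply: nlt; exact: mem_set.
exists s; split => // [x|n x]; last by rewrite (le_trans (sle 0%N n x _))//= subr0.
apply/cvgrPdist_le => e e0.
have [||y [xy Dy]] := Ddense (ball (f x) e).
- by exists (f x); exact: ballxx.
- exact: ball_open.
exists (h y).+1 => // n /= hn.
rewrite (le_trans (sle _ _ x hn))// (le_trans (sg _ _))// gD//.
by move: xy; rewrite -ball_normE => /ltW.
Qed.

Lemma dist_measurable_cvg (V : normedModType R) (s : nat -> T -> V) (f : T -> V) :
  (forall n, simple_map (s n)) -> (forall x, s n x @[n --> \oo] --> f x) ->
  dist_measurable f.
Proof.
move=> sS sf v.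
apply: (measurable_fun_cvg (h := fun n x => `|s n x - v|)) => [n|x _].
  exact: (measurable_simple_dep (F := fun w _ => `|w - v|) (sS n)).
by apply: cvg_norm; apply: cvgB; [exact: sf|exact: cvg_cst].
Qed.

End simple_approximation.

Section tensor.
Context (R : realType) (H : hilbertType R).

Lemma tensor_norm (u v : H) : `|tensor u v| <= `|u| * `|v|.
Proof.
rewrite -(@ler_pXn2r _ 2) ?nnegrE ?mulr_ge0// exprMn mulrC -lee_fin.
have -> : (`|tensor u v| ^+ 2)%:E = hs_sqnorm (tensor u v) by rewrite S2_sqnorm.
have [oB _] := hbasisP H.
apply: ge_ereal_sup => _ [F [finF FB] <-].
rewrite fsbig_finite//= sumEFin lee_fin.
rewrite (eq_bigr (fun e => inner e v ^+ 2 * `|u| ^+ 2)); last first.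
  by move=> e _; rewrite /rank_one normrZ exprMn real_normK ?num_real.
rewrite -mulr_suml ler_wpM2r ?sqr_ge0//; apply: bessel; first exact: fset_uniq.
by move=> x y /=; rewrite !in_fset_set// => /set_mem/FB Bx /set_mem/FB By; exact: oB.
Qed.

Lemma tensorBl (u u' v : H) : tensor (u - u') v = tensor u v - tensor u' v.
Proof. by apply/val_inj/funext => h; rewrite /= /rank_one scalerBr. Qed.

Lemma tensorBr (u v v' : H) : tensor u (v - v') = tensor u v - tensor u v'.
Proof.
by apply/val_inj/funext => h; rewrite /= /rank_one innerDr innerNr scalerBl.
Qed.

Lemma tensor_dist (u v u' v' : H) :
  `|tensor u v - tensor u' v'| <= `|u - u'| * `|v| + `|u'| * `|v - v'|.
Proof.
have -> : tensor u v - tensor u' v' = tensor (u - u') v + tensor u' (v - v').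
  by rewrite tensorBl tensorBr addrA subrK.
by rewrite (le_trans (ler_normD _ _))// lerD// tensor_norm.
Qed.

End tensor.

Section bochner_tensor.
Context (R : realType) d (T : measurableType d) (mu : probability T R).
Context (H : hilbertType R) (f1 f2 : T -> H).
Hypotheses (sepH : Defs.separable H).
Hypotheses (mf1 : dist_measurable f1) (mf2 : dist_measurable f2).

(** The tensors of the simple approximations of [f1] and [f2]; the right-hand side
    of the last bound is the dominating function for square integrable factors. *)
Let approx : exists t : nat -> T -> S2 H, [/\ forall n, simple_map (t n),
    forall x, t n x @[n --> \oo] --> tensor (f1 x) (f2 x) &
    forall n x, `|tensor (f1 x) (f2 x) - t n x| <=
      2 * (`|f1 x| ^+ 2 + `|f2 x| ^+ 2)].
Proof.
have [s1 [S1 c1 b1]] := simple_approx sepH mf1.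
have [s2 [S2 c2 b2]] := simple_approx sepH mf2.
exists (fun n x => tensor (s1 n x) (s2 n x)); split.
- by move=> n; exact: (simple_map2 (@tensor R H) (S1 n) (S2 n)).
- move=> x.
  have cb : `|f1 x - s1 n x| * `|f2 x| + `|s1 n x| * `|f2 x - s2 n x|
      @[n --> \oo] --> `|f1 x - f1 x| * `|f2 x| + `|f1 x| * `|f2 x - f2 x|.
    apply: cvgD; apply: cvgM; try exact: cvg_cst.
    + by apply: cvg_norm; apply: cvgB => //; exact: cvg_cst.
    + exact: cvg_norm.
    + by apply: cvg_norm; apply: cvgB => //; exact: cvg_cst.
  rewrite !subrr !normr0 mul0r mulr0 addr0 in cb.
  apply/cvgrPdist_le => e e0; move/cvgrPdist_le : cb => /(_ _ e0).
  apply: filterS => n; rewrite sub0r normrN => h.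
  by rewrite (le_trans (tensor_dist _ _ _ _))// (le_trans _ h)// ler_norm.
- move=> n x; apply: le_trans (tensor_dist _ _ _ _) _.
  have := b1 n x; have := b2 n x.
  have : `|s1 n x| <= `|f1 x| + `|f1 x - s1 n x|.
    have {1}-> : s1 n x = f1 x - (f1 x - s1 n x) by rewrite opprB addrC subrK.
    exact: ler_normB.
  have := normr_ge0 (s1 n x); have := normr_ge0 (f1 x - s1 n x).
  have := normr_ge0 (f2 x - s2 n x).
  have := normr_ge0 (f1 x); have := normr_ge0 (f2 x).
  move: `|f1 x| `|f2 x| `|f1 x - _| `|f2 x - _| `|s1 n x| => a b p q r.
  move=> b0 a0 q0 p0 r0 rp qb pa.
  have h1 : p * b <= a * b by rewrite ler_wpM2r.
  have h2 : r * q <= (2 * a) * b by rewrite ler_pM//; lra.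
  have := sqr_ge0 (a - b); nra.
Qed.

Lemma dist_measurable_tensor : dist_measurable (fun x => tensor (f1 x) (f2 x)).
Proof. by have [t [tS tc _]] := approx; exact: dist_measurable_cvg tS tc. Qed.

Lemma has_bochner_integral_tensor :
  (\int[mu]_x (`|f1 x| ^+ 2)%:E < +oo)%E -> (\int[mu]_x (`|f2 x| ^+ 2)%:E < +oo)%E ->
  exists I, has_bochner_integral mu (fun x => tensor (f1 x) (f2 x)) I.
Proof.
move=> f1oo f2oo; have [t [tS tc tb]] := approx.
apply: (has_bochner_integral_exists (@S2_complete R H) dist_measurable_tensor tS tc).
have norm_meas (f : T -> H) : dist_measurable f ->
    measurable_fun setT (fun x => `|f x| ^+ 2).
  by move=> mf; apply: measurable_funX; exact: dist_measurable_norm.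
have sqi (f : T -> H) : dist_measurable f -> (\int[mu]_x (`|f x| ^+ 2)%:E < +oo)%E ->
    mu.-integrable setT (EFin \o (fun x => `|f x| ^+ 2)).
  move=> mf fi; apply/integrableP; split; first exact/measurable_EFinP/norm_meas.
  by under eq_integral do rewrite /= ger0_norm ?sqr_ge0//.
have ig : mu.-integrable setT (fun x => 2%:E * ((`|f1 x| ^+ 2)%:E + (`|f2 x| ^+ 2)%:E))%E.
  apply: (integrableZl measurableT).
  exact: (integrableD measurableT (sqi _ mf1 f1oo) (sqi _ mf2 f2oo)).
have [||||_ + _] := @dominated_convergence _ _ _ mu setT measurableT
    (fun n x => `|tensor (f1 x) (f2 x) - t n x|%:E) (cst 0%E) _ _ _ _ ig.
- by move=> n; exact: measurable_dist_simple dist_measurable_tensor (tS n).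
- exact: measurable_cst.
- apply: aeW => x _; apply: cvg_EFin; first exact: nearW.
  have : `|tensor (f1 x) (f2 x) - t n x| @[n --> \oo] -->
      `|tensor (f1 x) (f2 x) - tensor (f1 x) (f2 x)|.
    by apply: cvg_norm; apply: cvgB => //; exact: cvg_cst.
  by rewrite subrr normr0.
- by apply: aeW => x n _; rewrite lee_fin normr_id; exact: tb.
apply: cvg_trans; apply: near_eq_cvg; apply: nearW => n /=.
by apply: eq_integral => x _; rewrite /= subr0 normr_id.
Qed.

End bochner_tensor.

(** * Convergence of the empirical autocovariance operators *)

Lemma measurable_fun_dist_borel (R : realType) (V : normedModType R) (v : V) :
  measurable_fun [set: borel V] (fun x : borel V => `|(x : V) - v|).
Proof.
apply: (measurability (@RGenOInfty.G R)); first exact: RGenOInfty.measurableE.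
move=> _ [_ [r ->] <-]; apply: measurableI => //; apply: sub_sigma_algebra.
have -> : (fun x : borel V => `|(x : V) - v|) @^-1` `]r, +oo[%classic =
    (fun x : V => `|x - v|) @^-1` [set y | r < y].
  by apply/seteqP; split => x /=; rewrite in_itv/= andbT.
apply: open_comp; last exact: open_gt.
move=> x _; apply: cvg_norm; apply: cvgB => //; exact: cvg_cst.
Qed.

Section feature_paths.
Context (R : realType) d (Omega : measurableType d) (P : probability Omega R).
Context (E : ptopologicalType) (X : int -> {mfun Omega >-> borel E}).
Context (H : rkhs R E).
Hypothesis mfeature : measurable_fun setT (feature H : borel E -> borel H).

Lemma dist_measurable_feature (i : int) :
  dist_measurable (fun x : path_space E => feature H (x i)).
Proof.
move=> v; have := measurableT_comp mfeature (@measurable_coord E i).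
by move=> /(measurableT_comp (measurable_fun_dist_borel v)).
Qed.

Hypothesis stat : stationary P X.

(** By shift invariance every [X i] has the second moment of [X 0]. *)
Lemma integral_sqr_feature (i : nat) :
  (\int[path_law P X]_x (`|feature H (x i%:Z)| ^+ 2)%:E =
   \int[P]_w (`|feature H (X 0 w)| ^+ 2)%:E)%E.
Proof.
have mf j : measurable_fun setT
    (fun x : path_space E => (`|feature H (x j)| ^+ 2)%:E).
  apply/measurable_EFinP; apply: measurable_funX.
  exact: dist_measurable_norm (@dist_measurable_feature j).
elim: i => [|i <-].
  by rewrite -(ge0_integral_comp (trajectory_preserving P X) (mf 0)).
rewrite -(ge0_integral_comp (shift_preserving stat) (mf i%:Z))//.
by apply: eq_integral => x _; rewrite /Defs.shift intS addrC.
Qed.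

End feature_paths.

Theorem corollary10 (R : realType) (d : measure_display)
    (Omega : measurableType d) (P : probability Omega R)
    (E : ptopologicalType) (X : int -> {mfun Omega >-> borel E})
    (H : rkhs R E) :
  polish R E ->
  separable H ->
  measurable_fun setT (feature H : borel E -> borel H) ->
  square_integrable P (fun w => feature H (X 0 w)) ->
  bochner_integral P (fun w => feature H (X 0 w)) = 0 ->
  stationary P X ->
  ergodic P X ->
  forall eta : nat,
    {ae P, forall w, empirical_autocov X H eta n w @[n --> \oo]
                       --> autocov P X H eta}.
Proof.
move=> _ sepH mfeature [_ sq] _ stat erg eta.
pose F (x : path_space E) := tensor (feature H (x eta%:Z)) (feature H (x 0)).
have mf i := dist_measurable_feature mfeature i.
have mF : dist_measurable F by exact: dist_measurable_tensor.
have [I FI] : exists I, has_bochner_integral (path_law P X) F I.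
  apply: has_bochner_integral_tensor => //; first by rewrite integral_sqr_feature.
  by rewrite (integral_sqr_feature mfeature stat 0).
have pathP := trajectory_preserving P X.
have shiftP := shift_preserving stat.
have FpathI : has_bochner_integral P (F \o trajectory X) I.
  exact: has_bochner_integral_comp pathP mF FI.
have mFpath : dist_measurable (F \o trajectory X).
  by move=> v; exact: measurableT_comp (mF v) pathP.1.
have -> : autocov P X H eta = I.
  rewrite /autocov /bochner_integral; case: xgetP => [J _ FJ|/(_ I)//].
  exact: has_bochner_integral_unique mFpath FJ FpathI.
(* the empirical sum starts at time 1, whence the extra shift *)
have := ae_comp pathP (ae_comp shiftP
  (bochner_birkhoff shiftP (path_ergodic erg) mF FI)).
apply: filterS => w; apply: cvg_trans; apply: near_eq_cvg; apply: nearW => n.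
rewrite /empirical_autocov big_add1 /= big_mkord; congr (_ *: _).
apply: eq_bigr => i _; rewrite -iterSr /F !iter_shift /trajectory add0r.
by rewrite -PoszD addnC.
Qed.
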